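(* Let $n,m\ge0$ be integers and let $\lambda,\mu$ be partitions with $\mu\subset\lambda$ and $\ell(\lambda)\le n$. Then \[ |\mathrm{LHT}_{n,m}(\lambda/\mu)| = m^{|\lambda/\mu|}\prod_{x\in\lambda/\mu}(n+c(x))\;\sum_{D}\;\prod_{x\in\lambda\setminus D}\frac{1}{h(x)}, \] where the sum is over all excited diagrams $D$ of $\lambda/\mu$.
   Context: $\mathbb N=\{0,1,2,\dots\}$. A partition $\lambda$ is identified with its Young diagram $\{(i,j):1\le i\le \ell(\lambda),\,1\le j\le\lambda_i\}$, where $\ell(\lambda)$ is the number of (positive) parts; $\mu\subset\lambda$ means containment of diagrams, $\lambda/\mu$ is the set difference, and $|\lambda/\mu|$ its number of cells. The content of a cell is $c(i,j)=j-i$ and the hook length (in $\lambda$) is $h(i,j)=\lambda_i+\lambda_j'-i-j+1$, where $\lambda'_j=\#\{r:\lambda_r\ge j\}$. Excited diagrams of $\lambda/\mu$: the subsets $D\subset\lambda$ obtained from the diagram of $\mu$ by a (possibly empty) sequence of excited moves, where an excited move replaces a cell $(i,j)\in D$ by $(i+1,j+1)$, allowed when $(i,j+1),(i+1,j),(i+1,j+1)$ all lie in $\lambda\setminus D$. An $n$-lecture hall tableau of shape $\lambda/\mu$ is a map $L:\lambda/\mu\to\mathbb N$ such that \[ \frac{L(i,j)}{n+c(i,j)}\ge\frac{L(i,j+1)}{n+c(i,j+1)},\qquad \frac{L(i,j)}{n+c(i,j)}>\frac{L(i+1,j)}{n+c(i+1,j)} \] whenever the cells involved lie in $\lambda/\mu$.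 $\mathrm{LHT}_{n,m}(\lambda/\mu)$ is the set of such $L$ with $\lfloor L(i,j)/(n-i+j)\rfloor<m$ for every $(i,j)\in\lambda/\mu$. Convention: $0^0=1$. *)

(* Defs.v *)
From mathcomp Require Import all_boot all_order all_algebra.
From mathcomp Require Import finmap.
From mathcomp Require Import boolp classical_sets cardinality.

Set Implicit Arguments.
Unset Strict Implicit.
Unset Printing Implicit Defensive.

Import Order.TTheory GRing.Theory Num.Theory.

Local Open Scope ring_scope.

(* Partitions are the sequences of their parts, so l(p) = size p. Rows and    *)
(* columns are numbered from 0: the cell written (i + 1, j + 1) with 1-based  *)
(* indices is (i, j) here.                                                    *)
Definition is_partition (p : seq nat) : bool := sorted geq p && (0%N \notin p).

Definition in_diagram (p : seq nat) (i j : nat) : bool := (j < nth 0 p i)%N.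

Definition part_sub (mu la : seq nat) : Prop :=
  forall i j : nat, in_diagram mu i j -> in_diagram la i j.

(* The bounding box of the diagram of la, a finite type of cells.             *)
Notation cell la := ('I_(size la) * 'I_(head 0%N la))%type.

(* The cells of p inside the box of la: all of them if part_sub p la.         *)
Definition diagram (la p : seq nat) : {set cell la} :=
  [set x : cell la | in_diagram p x.1 x.2]%SET.

Definition skew_diagram (la mu : seq nat) : {set cell la} :=
  diagram la la :\: diagram la mu.

Definition content (la : seq nat) (x : cell la) : int := x.2%:Z - x.1%:Z.

Definition conj_part (p : seq nat) (j : nat) : nat :=
  count (fun r => (j < r)%N) p.

(* With 1-based indices, h(i, j) = la_i + la'_j - i - j + 1.                  *)
Definition hook (la : seq nat) (x : cell la) : int :=
  (nth 0%N la x.1)%:Z + (conj_part la x.2)%:Z - x.1%:Z - x.2%:Z - 1.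

(* With x = (i, j) and y = (i + 1, j + 1), the cells (x.1, y.2) and (y.1, x.2)*)
(* are (i, j + 1) and (i + 1, j).                                             *)
Definition excited_move (la : seq nat) : rel {set cell la} := fun D D' =>
  [exists x : cell la, exists y : cell la,
    [&& x \in D,
        y.1 == x.1.+1 :> nat,
        y.2 == x.2.+1 :> nat,
        (x.1, y.2) \in diagram la la :\: D,
        (y.1, x.2) \in diagram la la :\: D,
        y \in diagram la la :\: D
      & D' == y |: (D :\ x)]].

Definition excited (la mu : seq nat) : pred {set cell la} :=
  connect (@excited_move la) (diagram la mu).

Notation skew_cell la mu := {x | x \in skew_diagram la mu}.

Definition lh_ratio (n : nat) (la mu : seq nat)
    (L : {ffun skew_cell la mu -> nat}) (x : skew_cell la mu) : rat :=
  (L x)%:R / (n%:Z + content (val x))%:~R.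

Definition lecture_hall_tableau (n : nat) (la mu : seq nat)
    (L : {ffun skew_cell la mu -> nat}) : Prop :=
  (forall x y : skew_cell la mu,
      (val y).1 = (val x).1 :> nat -> (val y).2 = (val x).2.+1 :> nat ->
      lh_ratio n L y <= lh_ratio n L x) /\
  (forall x y : skew_cell la mu,
      (val y).1 = (val x).1.+1 :> nat -> (val y).2 = (val x).2 :> nat ->
      lh_ratio n L y < lh_ratio n L x).

Definition LHT (n m : nat) (la mu : seq nat) :
    set {ffun skew_cell la mu -> nat} :=
  [set L | lecture_hall_tableau n L /\
     forall x : skew_cell la mu, Num.floor (lh_ratio n L x) < m%:Z]%classic.

Arguments LHT : clear implicits.

(* Main.v *)
Require Import Defs.
From mathcomp Require Import all_boot all_order all_algebra.
From mathcomp Require Import finmap.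
From mathcomp Require Import boolp classical_sets cardinality.
From mathcomp Require Import perm zify ring.

Set Implicit Arguments.
Unset Strict Implicit.
Unset Printing Implicit Defensive.

Import Order.TTheory GRing.Theory Num.Theory.

Local Open Scope ring_scope.

(** Both sides, as functions of mu for a fixed la, satisfy the same recursion on
adding a box to mu, and they agree at mu = la. Let N be the number of cells of
la/mu. The two recursions are

    N * |LHT (la/mu)| = m * \sum (n + c) * |LHT (la/mu+)|

    N * E (la/mu) = \sum E (la/mu+)

where mu+ runs over the partitions inside la with one box more than mu, c is the
content of that box, and E is the sum over excited diagrams. Multiplying the
second by m^N times the product of the n + c over la/mu gives the first.

A partition is encoded by the positions of particles on a line; a box of content
c moves a particle from n + c - 1 to n + c. Both sides become sums over the
subwords of a word of such moves.

For tableaux, write an entry of the cell x as v = k (n + c(x)) + s with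
s < n + c(x). The ratio conditions say that the pairs (k, s) weakly decrease
along rows and strictly decrease down columns. Hence a tableau is a way to add
the cells of la/mu one by one along a fixed word of keys (tableauxP,
tableau_lecture_hall), and the Lindstroem-Gessel-Viennot principle counts these
ways by a determinant of one-particle path numbers (size_tableaux). The word
consists of m copies of one that acts on a single particle as the Pascal matrix;
the matrix of the whole word is therefore an exponential, which satisfies a
derivation rule (paths_derivation). Applied to the rows of the determinant this
rule is the first recursion (det_path_recursion).

For excited diagrams, read the cells of la row by row. An excited move only
exchanges commuting moves of particles, and a subset of cells is an excited
diagram of mu if and only if its reading word builds mu (excitedP). The weights
of the Billey formula for localized Schubert classes are, for this word, the
hook lengths (cell_weight_hook). The second recursion is the Chevalley formula,
which has a short induction on the word once the parameters are generic
(subword_sum_chevalley).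

The two are compared in count_det_excited. *)

(** * Particle configurations and the Chevalley formula *)

(** Strictly decreasing positions of r particles on the half-line of naturals
encode a partition with at most r parts: row i sits at n - 1 - i + mu_i, and
adding a box of content c in row i moves particle i from n + c - 1 to n + c. *)
Notation config r := {ffun 'I_r -> nat}.

Definition swap (c p : nat) : nat :=
  if p == c then c.-1 else if p == c.-1 then c else p.

Definition swapc r (c : nat) (a : config r) : config r :=
  [ffun i => swap c (a i)].

Definition occupied r (a : config r) (p : nat) : bool := [exists i, a i == p].

Definition can_hop r (c : nat) (a : config r) : bool := occupied a c.-1 && ~~ occupied a c.

Definition can_unhop r (c : nat) (a : config r) : bool :=
  occupied a c && ~~ occupied a c.-1.

Lemma swapK c : involutive (swap c).
Proof. by move=> p; rewrite /swap; repeat case: eqP => //=; lia. Qed.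

Lemma swapcK r c : involutive (@swapc r c).
Proof. by move=> a; apply/ffunP => i; rewrite !ffunE swapK. Qed.

Lemma swapc_inj r c (a : config r) : injective a -> injective (swapc c a).
Proof. by move=> inja i j; rewrite !ffunE => /(can_inj (swapK c)) /inja. Qed.

Lemma occupiedP r (a : config r) p : reflect (exists i, a i = p) (occupied a p).
Proof. by apply: (iffP existsP) => -[i /eqP]; exists i => //; apply/eqP. Qed.

Lemma occupied_swapc r c (a : config r) p : occupied (swapc c a) p = occupied a (swap c p).
Proof.
apply/occupiedP/occupiedP => -[i]; first by rewrite ffunE => <-; exists i; rewrite swapK.
by move=> Hi; exists i; rewrite ffunE Hi swapK.
Qed.

Lemma swap_top c : swap c c = c.-1.
Proof. by rewrite /swap eqxx. Qed.

Lemma swap_bot c : swap c c.-1 = c.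
Proof. by rewrite /swap eqxx; case: eqP => // ->. Qed.

Lemma swap_id c p : p != c -> p != c.-1 -> swap c p = p.
Proof. by rewrite /swap => /negPf-> /negPf->. Qed.

Lemma can_hop_swapc r c (a : config r) : can_hop c (swapc c a) = can_unhop c a.
Proof. by rewrite /can_hop /can_unhop !occupied_swapc swap_top swap_bot. Qed.

Lemma can_unhop_swapc r c (a : config r) : can_unhop c (swapc c a) = can_hop c a.
Proof. by rewrite -can_hop_swapc swapcK. Qed.

Section Occupation.
Variable R : comNzRingType.

Lemma sum_occupied r (a : config r) p : injective a ->
  \sum_i (a i == p)%:R = (occupied a p)%:R :> R.
Proof.
move=> inja; case: occupiedP => [[i0 <-]|no].
  rewrite (bigD1 i0) //= eqxx big1 ?addr0 // => i ne; case: eqP => // /inja E.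
  by rewrite E eqxx in ne.
by rewrite big1 // => i _; case: eqP => // E; case: no; exists i.
Qed.

Definition total r (t : nat -> R) (a : config r) : R := \sum_i t (a i).

Lemma total_swapc r t c (a : config r) : (0 < c)%N -> injective a ->
  total t (swapc c a) =
  total t a + (t c - t c.-1) * ((occupied a c.-1)%:R - (occupied a c)%:R).
Proof.
move=> c0 inja; rewrite -!(sum_occupied _ inja) -sumrB mulr_sumr -big_split /=.
apply: eq_bigr => i _; rewrite ffunE /swap.
case: (a i =P c) => [->|_]; first by rewrite gtn_eqF ?prednK //=; ring.
by case: eqP => [->|_] /=; ring.
Qed.

(** The weighted number of subwords of w whose boxes, added one after the other
from the last letter of w to the first, lead from a0 to a. The weights are the
ones that the Billey formula prescribes: a letter weighs t c - t (c - 1), where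
t has first been permuted by the letters standing before it. *)
Fixpoint subword_sum r (a0 : config r) (t : nat -> R) (w : seq nat) (a : config r)
    : R :=
  if w is c :: w' then
    subword_sum a0 (t \o swap c) w' a +
    if can_unhop c a then
      (t c - t c.-1) * subword_sum a0 (t \o swap c) w' (swapc c a)
    else 0
  else (a == a0)%:R.

Definition cover_sum r (F : config r -> R) (a : config r) : R :=
  \sum_(i | can_hop (a i).+1 a) F (swapc (a i).+1 a).

Lemma swapc_comm r c d (a : config r) : (0 < c)%N -> (0 < d)%N ->
  c != d -> c.-1 != d -> c != d.-1 ->
  swapc c (swapc d a) = swapc d (swapc c a).
Proof.
move=> c0 d0 n1 n2 n3; apply/ffunP => i; rewrite !ffunE /swap.
by repeat case: eqP => //=; lia.
Qed.

(** Moving a particle elsewhere commutes with the exchange of the sites c - 1 and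
c, except for the move of the exchanged particle itself: this is the
correction term F a. *)
Lemma cover_sum_unhop r (F : config r -> R) c (a : config r) :
  (0 < c)%N -> injective a -> can_unhop c a ->
  \sum_(i | can_hop (a i).+1 a) (if can_unhop c (swapc (a i).+1 a)
     then F (swapc c (swapc (a i).+1 a)) else 0) =
  cover_sum F (swapc c a) - F a.
Proof.
move=> c0 inja ca; have /andP[/occupiedP[i0 Hi0] nb] := ca.
rewrite /cover_sum [in RHS](bigD1 i0) /=; last first.
  by rewrite ffunE Hi0 swap_top prednK // can_hop_swapc.
rewrite ffunE Hi0 swap_top prednK // swapcK addrAC subrr add0r.
rewrite -big_mkcondr /=; apply: eq_big => [i|i /andP[hi /andP[oc noc]]].
  have [->|ne] := eqVneq i i0.
    rewrite andbF Hi0 /can_hop /can_unhop !occupied_swapc (swap_bot c.+1).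
    by case: (occupied a c.+1); rewrite ?andbF.
  have nec : a i != c by apply: contra_neq ne => E; apply: inja; rewrite E.
  have neb : a i != c.-1 by apply: contraNneq nb => E; apply/occupiedP; exists i.
  rewrite andbT ffunE swap_id //.
  have [E|neE] := eqVneq (a i).+1 c.-1.
    rewrite /can_unhop /can_hop !occupied_swapc E swap_top.
    have -> : occupied a c.-1.-1 by apply/occupiedP; exists i; rewrite -E.
    rewrite (swap_bot c); have -> : occupied a c by case/andP: ca.
    by rewrite !andbF.
  rewrite /can_unhop /can_hop !occupied_swapc !(@swap_id c); try by lia.
  rewrite !swap_id; try by lia.
  by case/andP: ca => -> ->; rewrite !andbT.
have nec : a i != c.
  apply/eqP => E; move: oc hi; rewrite /can_hop !occupied_swapc E (swap_bot c.+1).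
  by move=> ->; rewrite andbF.
have neb : a i != c.-1 by apply: contraNneq nb => E; apply/occupiedP; exists i.
have neb1 : (a i).+1 != c.-1.
  apply: contraNneq noc => E; rewrite occupied_swapc E swap_top -E /=.
  by apply/occupiedP; exists i.
by rewrite ffunE swap_id // swapc_comm //; lia.
Qed.

Lemma can_unhop_hop r c d (a : config r) : (0 < c)%N -> (0 < d)%N ->
  can_hop d a -> can_unhop c (swapc d a) -> (c == d) || can_unhop c a.
Proof.
move=> c0 d0 /andP[od nd]; rewrite /can_unhop !occupied_swapc.
have [//|ncd] := eqVneq c d; rewrite /swap (negPf ncd) /=.
have [_|ncd1] := eqVneq c d.-1; first by rewrite (negPf nd).
have [E|_] := eqVneq c.-1 d; first by rewrite od andbF.
by have [E|_] := eqVneq c.-1 d.-1; first lia.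
Qed.

(** The Chevalley formula of equivariant Schubert calculus, for an arbitrary word
and arbitrary parameters t. Induction on the word is possible because t is
arbitrary: peeling off the letter c permutes t by the transposition (c-1 c),
and a case analysis on which of c - 1 and c are occupied shows that the weight
t c - t (c - 1) is exactly what makes both sides change by the same amount.
The bound g keeps the particles in the range where a0 is minimal. *)
Lemma subword_sum_chevalley r (a0 : config r) g (w : seq nat) (t : nat -> R) :
  (forall i (a : config r), injective a -> (forall k, g <= a k)%N ->
     can_hop (a i).+1 a -> swapc (a i).+1 a != a0) ->
  all (fun c => g < c)%N w ->
  forall a : config r, injective a -> (forall i, g <= a i)%N ->
  cover_sum (subword_sum a0 t w) a =
  (total (foldl (fun u c => u \o swap c) t w) a0 - total t a) * subword_sum a0 t w a.
Proof.
move=> Ha0; elim: w t => [|c w IH] t /=.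
  move=> _ a inja ga; rewrite /cover_sum big1; last first.
    by move=> i ci; rewrite (negPf (Ha0 i a inja ga ci)).
  by case: eqP => [->|_]; rewrite ?subrr ?mul0r ?mulr0.
move=> /andP[gc gw] a inja ga; have c0 : (0 < c)%N by lia.
set F := subword_sum a0 (t \o swap c) w; set T := total _ a0; set h := t c - _.
have IHa (b : config r) : injective b -> (forall i, g <= b i)%N ->
    cover_sum F b = (T - total (t \o swap c) b) * F b by apply: IH.
have Ea (b : config r) : total (t \o swap c) b = total t (swapc c b).
  by rewrite /total; apply: eq_bigr => i _; rewrite ffunE.
have gs : forall i, (g <= swapc c a i)%N.
  by move=> i; rewrite ffunE /swap; have := ga i; repeat case: eqP; lia.
have injs := swapc_inj (c:=c) inja.
rewrite {1}/cover_sum big_split /= -/(cover_sum F a) IHa // Ea.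
set S := \sum_(i | _) _.
have -> : S = h * \sum_(i | can_hop (a i).+1 a)
    (if can_unhop c (swapc (a i).+1 a) then F (swapc c (swapc (a i).+1 a)) else 0).
  by rewrite mulr_sumr; apply: eq_bigr => i _; case: ifP; rewrite ?mulr0.
have tot := total_swapc t c0 inja.
(* Both sides change only through the occupation of c - 1 and c. *)
case cu : (can_unhop c a).
  rewrite cover_sum_unhop // IHa // Ea swapcK.
  rewrite tot; case/andP: cu => -> /negPf->; rewrite -/h /=; ring.
rewrite addr0.
case ch : (can_hop c a); last first.
  rewrite big1 ?mulr0 ?addr0; last first.
    move=> i hi; case: ifP => // un.
    have /orP[/eqP E|] := can_unhop_hop c0 (isT : 0 < (a i).+1)%N hi un.
      by rewrite E hi in ch.
    by rewrite cu.
  rewrite tot.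
  by move: cu ch; rewrite /can_hop /can_unhop; do 2![case: (occupied a _)] => // _ _; ring.
have /andP[/occupiedP[i0 Hi0] nc] := ch.
rewrite (bigD1 i0) /=; last by rewrite Hi0 prednK.
rewrite big1 ?addr0; last first.
  move=> i /andP[hi ne]; case: ifP => // un.
  have /orP[/eqP E|] := can_unhop_hop c0 (isT : 0 < (a i).+1)%N hi un.
    by case/eqP: ne; apply: inja; rewrite Hi0 E.
  by rewrite cu.
rewrite Hi0 prednK // can_unhop_swapc ch swapcK tot.
by case/andP: ch => -> /negPf->; rewrite -/h /=; ring.
Qed.

End Occupation.

(** * Determinants of one-particle paths *)

(** The number of ways for one particle to go from p to q by the letters of w, the
letter c allowing (not forcing) the step from c - 1 to c. *)
Fixpoint paths (w : seq nat) (p q : nat) : nat :=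
  if w is c :: w' then (paths w' p q + (p == c.-1) * paths w' c q)%N
  else (p == q).

Lemma paths_lt w p q : (q < p)%N -> all (leq 1) w -> paths w p q = 0%N.
Proof.
elim: w p => [|c w IH] p /=; first by move=> lt; rewrite gtn_eqF.
move=> lt /andP[c0 w0]; rewrite IH // add0n.
by case: eqP => // E; rewrite mul1n IH //; lia.
Qed.

Definition strict r (a : config r) : Prop :=
  forall i k : 'I_r, (i < k)%N -> (a k < a i)%N.

Definition below r (a l : config r) : bool := [forall i, a i <= l i]%N.

Lemma strict_inj r (a : config r) : strict a -> injective a.
Proof.
move=> sa i k E; apply/eqP; case: (ltngtP i k) => [/sa|/sa|/val_inj->//].
  by rewrite E ltnn.
by rewrite E ltnn.
Qed.

Lemma strict_le r (a : config r) (i k : 'I_r) :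
  strict a -> (i <= k -> a k + (k - i) <= a i)%N.
Proof.
move=> sa; have [e] := ubnP (k - i)%N; elim: e k => // e IH k lt le.
have [E|ne] := eqVneq i k; first by rewrite E subnn addn0.
have ik : (i < k)%N by rewrite ltn_neqAle le andbT.
have hk : (k.-1 < r)%N by have := ltn_ord k; lia.
have := IH (Ordinal hk); have := sa (Ordinal hk) k; rewrite /=; lia.
Qed.

Lemma strict_swapc r c (a : config r) : (0 < c)%N -> strict a -> can_hop c a ->
  strict (swapc c a).
Proof.
move=> c0 sa /andP[_ nc] i k lt; have lta := sa _ _ lt.
have neq j : a j != c by apply: contraNneq nc => E; apply/occupiedP; exists j.
by rewrite !ffunE /swap !(negPf (neq _)); have := neq i; repeat case: eqP; lia.
Qed.

Section Determinant.
Variables (R : comNzRingType) (r : nat).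
Implicit Types (a l : config r) (w : seq nat).

Definition path_mx w a l : 'M[R]_r := \matrix_(i, j) (paths w (a i) (l j))%:R.

Lemma det_path_occ w a l i (N : 'M[R]_r) c : injective a ->
  occupied a c -> a i != c ->
  (forall j, N i j = (paths w c (l j))%:R) ->
  (forall k j, k != i -> N k j = path_mx w a l k j) -> \det N = 0.
Proof.
move=> inja /occupiedP[k Hk] ne Ni Nk.
apply: (@determinant_alternate _ _ _ i k).
  by apply: contraNneq ne => ->; rewrite Hk.
by move=> j; rewrite Ni Nk ?mxE ?Hk //; apply: contraNneq ne => <-; rewrite Hk.
Qed.

(** If the row of particle i is replaced by the row of the next site, the result is
either the matrix of the moved configuration or has two equal rows, when the
next site is occupied. *)
Lemma det_path_swapc w a l i (N : 'M[R]_r) : injective a ->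
  (forall j, N i j = (paths w (a i).+1 (l j))%:R) ->
  (forall k j, k != i -> N k j = path_mx w a l k j) ->
  \det N = if can_hop (a i).+1 a then \det (path_mx w (swapc (a i).+1 a) l) else 0.
Proof.
move=> inja Ni Nk; rewrite /can_hop [occupied _ _](introT (occupiedP _ _)) /=; last by exists i.
case: ifPn => [no|/negbNE oc]; last by apply: (det_path_occ inja oc _ Ni Nk); lia.
congr (\det _); apply/matrixP => k j; rewrite !mxE ffunE.
have [->|ne] := eqVneq k i; first by rewrite (swap_bot (a i).+1) Ni.
rewrite Nk // !mxE swap_id //.
  by apply: contraNneq no => E; apply/occupiedP; exists k.
by apply: contraNneq ne => /= /inja ->.
Qed.

(** The particles do not interact in the determinant, yet by multilinearity and
alternation it satisfies the recursion of the exclusion process, in which a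
particle cannot enter an occupied site. *)
Lemma det_path_cons c w a l : (0 < c)%N -> injective a ->
  \det (path_mx (c :: w) a l) =
  \det (path_mx w a l) + if can_hop c a then \det (path_mx w (swapc c a) l) else 0.
Proof.
move=> c0 inja; have [/occupiedP[i Hi]|no] := boolP (occupied a c.-1); last first.
  rewrite /can_hop (negPf no) addr0; congr (\det _); apply/matrixP => i j.
  rewrite !mxE /=; case: eqP => [E|_]; last by rewrite addn0.
  by case/negP: no; apply/occupiedP; exists i.
pose N := \matrix_(k, j) if k == i then (paths w c (l j))%:R
                         else path_mx w a l k j : R.
have -> : c = (a i).+1 by rewrite Hi prednK.
rewrite -(@det_path_swapc w a l i N) //; last 2 first.
- by move=> j; rewrite mxE eqxx Hi prednK.
- by move=> k j ne; rewrite mxE (negPf ne).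
rewrite -[\det N]mul1r -[X in X + _]mul1r.
apply: (@determinant_multilinear _ _ _ _ _ i).
- apply/rowP => j; rewrite !mxE eqxx /= eqxx mul1n !mul1r natrD.
  by rewrite Hi prednK.
- apply/matrixP => k j; rewrite !mxE /=.
  case: eqP => [/inja /eqP|_]; last by rewrite addn0.
  by rewrite eq_sym (negPf (neq_lift _ _)).
apply/matrixP => k j; rewrite !mxE eq_sym (negPf (neq_lift _ _)) /=.
case: eqP => [/inja /eqP|_]; last by rewrite addn0.
by rewrite eq_sym (negPf (neq_lift _ _)).
Qed.

Lemma det_path_nbelow w a l : all (leq 1) w -> strict a -> strict l ->
  ~~ below a l -> \det (path_mx w a l) = 0.
Proof.
move=> w0 sa sl /forallPn[i]; rewrite -ltnNge => lt.
rewrite /determinant big1 // => s _.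
(* By the pigeonhole principle s cannot send the i + 1 rows up to i below i;
   a row k <= i sent to a column s k >= i gives a vanishing factor. *)
have [k lek ges] : exists2 k : 'I_r, (k <= i)%N & (i <= s k)%N.
  apply/exists_inP; rewrite -[X in is_true X]negbK negb_exists.
  apply/negP => /forallP no.
  have: [set s x | x in [set k : 'I_r | k <= i]%N] \subset [set k : 'I_r | k < i]%N.
    apply/fintype.subsetP => y /imsetP[x]; rewrite inE => xi ->; rewrite inE.
    by have := no x; rewrite negb_and xi /= -ltnNge.
  move=> /subset_leq_card; rewrite card_imset; last exact: perm_inj.
  rewrite [X in (X <= _)%N](cardsD1 i) inE leqnn.
  rewrite (_ : [set k : 'I_r | k <= i]%N :\ i = [set k : 'I_r | k < i]%N) ?ltnn //.
  by apply/setP => x; rewrite !inE ltn_neqAle.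
rewrite (bigD1 k) //= mxE paths_lt ?mul0r ?mulr0 //.
have le1 : (a i <= a k)%N.
  by case: (ltngtP k i) lek => // [/sa/ltnW//|/val_inj->].
have le2 : (l (s k) <= l i)%N.
  by case: (ltngtP i (s k)) ges => // [/sl/ltnW//|/val_inj<-].
by lia.
Qed.

Lemma det_path_nil a l : strict a -> strict l -> below a l ->
  \det (path_mx [::] a l) = (a == l)%:R.
Proof.
move=> sa sl bl; case: eqP => [->|ne].
  rewrite -[RHS](det1 R r); congr (\det _); apply/matrixP => i j; rewrite !mxE /=.
  by rewrite (inj_eq (strict_inj sl)).
have [i0 Hi0] : exists i, a i != l i.
  by apply/existsP; rewrite -[X in is_true X]negbK negb_exists; apply/negP =>
     /forallP E; apply: ne; apply/ffunP => i; apply/eqP/negbNE.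
(* The last row i with a_i <> l_i is zero: if a_i = l_j then j > i, and so
   a_j = l_j = a_i. *)
case: (@arg_maxnP _ i0 (fun i => a i != l i) (fun i : 'I_r => i : nat) Hi0).
move=> i Hi imax.
rewrite (expand_det_row _ i) big1 // => j _; rewrite mxE /=.
case: eqP => [E|_]; last by rewrite mul0r.
have lt : (a i < l i)%N by rewrite ltn_neqAle Hi (forallP bl).
have ij : (i < j)%N.
  case: (ltngtP i j) => // [/sl|/val_inj E']; first by lia.
  by move: Hi; rewrite E E' eqxx.
case: (eqVneq (a j) (l j)) => [E2|/imax]; last by lia.
by have := sa _ _ ij; rewrite E E2 ltnn.
Qed.

(** Every term of the Leibniz expansion picks each column exactly once, so scaling
the rows one at a time multiplies it by the sum of all the factors. *)
Lemma sum_det_scale_row (M : 'M[R]_r) (b : 'I_r -> R) :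
  \sum_i \det (\matrix_(k, j) (if k == i then b j * M k j else M k j)) =
  (\sum_j b j) * \det M.
Proof.
rewrite /determinant exchange_big mulr_sumr; apply: eq_bigr => s _ /=.
rewrite [in RHS](reindex_inj (@perm_inj _ s)) /= mulr_suml; apply: eq_bigr => i _.
rewrite mulrCA; congr (_ * _); rewrite (bigD1 i) //= [in RHS](bigD1 i) //=.
rewrite mxE eqxx mulrA; congr (_ * _).
by apply: eq_bigr => k /negPf ne; rewrite mxE ne.
Qed.

(** A derivation rule for one particle turns into one for the determinant: apply
it to one row at a time and sum over the rows. *)
Lemma det_path_recursion w a l (m : nat) : injective a ->
  (forall i j, ((l j)%:R - (a i)%:R) * (paths w (a i) (l j))%:R =
     (m * (a i).+1)%:R * (paths w (a i).+1 (l j))%:R :> R) ->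
  (\sum_j (l j)%:R - \sum_i (a i)%:R) * \det (path_mx w a l) =
  m%:R * \sum_(i | can_hop (a i).+1 a)
     (a i).+1%:R * \det (path_mx w (swapc (a i).+1 a) l).
Proof.
move=> inja H; rewrite mulrBl -sum_det_scale_row mulr_suml -sumrB mulr_sumr.
rewrite [in RHS]big_mkcond /=; apply: eq_bigr => i _.
pose N := \matrix_(k, j) if k == i then (paths w (a i).+1 (l j))%:R
                         else path_mx w a l k j : R.
set L := \matrix_(_, _) _.
(* The scaled row is l_j - a_i times the old one, plus a_i times the old one;
   by hypothesis the first summand is m (a_i + 1) times the row of a_i + 1. *)
have -> : \det L = (m * (a i).+1)%:R * \det N + (a i)%:R * \det (path_mx w a l).
  apply: (@determinant_multilinear _ _ _ _ _ i).
  - by apply/rowP => j; rewrite !mxE eqxx -H mulrBl subrK.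
  - by apply/matrixP => k j; rewrite !mxE eq_sym (negPf (neq_lift _ _)).
  by apply/matrixP => k j; rewrite !mxE eq_sym (negPf (neq_lift _ _)).
rewrite addrK (@det_path_swapc w a l i N) //; last 2 first.
- by move=> j; rewrite mxE eqxx.
- by move=> k j ne; rewrite mxE (negPf ne).
by case: ifP => _; rewrite ?mulr0 // natrM mulrA.
Qed.
End Determinant.

(** * The word of a bounded lecture hall tableau *)

Section Word.
Local Open Scope nat_scope.
Variable K : nat.

(** A key (v, c) stands for the entry v in a cell with n + content = c. Writing
v = k c + s with s < c, the number T = k K + s orders the entries of adjacent
cells in the same way as the ratios v / c do (lemmas prec_right, prec_down),
and block T lists the keys with a given T by increasing c. *)
Definition block (T : nat) : seq (nat * nat) :=
  [seq (T %/ K * c + T %% K, c) | c <- iota (T %% K).+1 (K - T %% K)].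

Fixpoint word (B : nat) : seq (nat * nat) :=
  if B is T.+1 then block T ++ word T else [::].

Definition letters (B : nat) : seq nat := [seq k.2 | k <- word B].

Lemma letters_succ T :
  letters T.+1 = iota (T %% K).+1 (K - T %% K) ++ letters T.
Proof. by rewrite /letters /= map_cat -map_comp map_id_in. Qed.

Lemma letters_gt0 B : all (leq 1) (letters B).
Proof.
elim: B => // T IH; rewrite letters_succ all_cat IH andbT.
by apply/allP => c; rewrite mem_iota; lia.
Qed.

(** Letters s+1, ..., s+d in increasing order let a particle standing in that range
move right by an arbitrary amount, and fix all the others. *)
Lemma paths_iota s d w p q : paths (iota s.+1 d ++ w) p q =
  if s <= p <= s + d then \sum_(p <= x < (s + d).+1) paths w x q
  else paths w p q.
Proof.
elim: d s p => [|d IH] s p /=.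
  rewrite addn0; case: ifP => // /andP[h1 h2].
  by rewrite (_ : p = s) ?big_nat1 //; lia.
rewrite !IH; have [->|ne] := eqVneq p s.
  rewrite ltnn leqnn leq_addr leqnn mul1n leq_addr /= [RHS]big_ltn; last by lia.
  by rewrite addSnnS.
rewrite mul0n addn0 addSnnS; congr (if _ then _ else _).
by lia.
Qed.

Lemma sum_bin_diag x s p : x <= K -> p <= K.+1 ->
  \sum_(p <= y < K.+1) (y <= x) * 'C(x - y + s, s) =
  (p <= x) * 'C(x - p + s.+1, s.+1).
Proof.
move=> xK pK; have [d] := ubnP (K.+1 - p); elim: d p pK => // d IH p pK lt.
have [E|ltp] := eqVneq p K.+1; first by rewrite E big_geq // leqNgt ltnS xK.
rewrite big_ltn ?IH; try by lia.
case: (ltngtP p x) => [h|h|->].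
- have -> : x - p.+1 + s.+1 = x - p + s by lia.
  by rewrite !mul1n addnS binS addnC.
- by [].
by rewrite subnn !add0n !binn.
Qed.

(** The number of one-particle paths from p to x through the last s blocks of a
period of K blocks. Only blocks of residue at most p move the particle, whence
the minimum. *)
Definition partial_bin (s p x : nat) : nat :=
  if s is s'.+1 then (p <= x) * 'C(x - p + minn p s', minn p s') else p == x.

(** Each further block sums over all later starting points, which is a diagonal
sum in the Pascal triangle. *)
Lemma paths_partial j s p q : s <= K -> p <= K ->
  paths (letters (j * K + s)) p q =
  \sum_(x < K.+1) partial_bin s p x * paths (letters (j * K)) x q.
Proof.
elim: s p => [|s IH] p sK pK.
  rewrite addn0 (bigD1 (inord p)) //= inordK // eqxx mul1n big1 ?addn0 // => i ne.
  by case: (eqVneq p i) => // E; rewrite E inord_val eqxx in ne.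
rewrite addnS letters_succ modnMDl modn_small // paths_iota subnKC ?(ltnW sK) // pK andbT.
case: leqP => [sp|ps]; last first.
  rewrite IH //; last by lia.
  apply: eq_bigr => x _; case: s sK ps {IH} => // s sK ps /=.
  by rewrite (minn_idPl _) 1?(minn_idPl _) //; lia.
transitivity (\sum_(p <= y < K.+1) \sum_(x < K.+1)
    partial_bin s y x * paths (letters (j * K)) x q).
  by apply: eq_big_nat => y hy; apply: IH; lia.
rewrite exchange_big /=; apply: eq_bigr => x _; rewrite -big_distrl /=.
congr (_ * _); rewrite (minn_idPr sp).
case: s sK sp {IH} => [|s] sK sp /=.
  rewrite addn0 bin0 muln1; case: leqP => [le|lt].
    rewrite (bigD1_seq (val x)) ?iota_uniq ?mem_index_iota //=; last first.
      by rewrite le ltn_ord.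
    by rewrite eqxx big1 // => i /negPf->.
  by rewrite big_nat big1 // => i /andP[h _]; rewrite gtn_eqF //; lia.
rewrite -sum_bin_diag; try by have := ltn_ord x; lia.
apply: eq_big_nat => y /andP[h _].
by rewrite (minn_idPr _) //; lia.
Qed.

(** A full period of K blocks acts on one particle as the Pascal matrix. *)
Lemma paths_period j p q : 0 < K -> p <= K.+1 -> q <= K ->
  paths (letters (j.+1 * K)) p q =
  \sum_(x < K.+1) 'C(x, p) * paths (letters (j * K)) x q.
Proof.
move=> K0 pK qK; case: (ltngtP p K.+1) pK => // [pK _|-> _]; last first.
  rewrite paths_lt ?letters_gt0 // big1 // => x _.
  by rewrite bin_small.
rewrite mulSn addnC paths_partial //.
apply: eq_bigr => x _; congr (_ * _).
case: K K0 pK qK x => // K' _ pK _ x /=.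
have [le|lt] := leqP p x; last by rewrite mul0n (bin_small lt).
have [E|ltp] := eqVneq p K'.+1; last first.
  by rewrite (minn_idPl _) ?subnK ?mul1n //; lia.
have -> : (x : nat) = K'.+1 by have := ltn_ord x; lia.
by rewrite E (minn_idPr _) // subnn add0n !binn.
Qed.

(** The Pascal matrix is the exponential of the operator that sends the site p to
p + 1 times the next site, so its m-th power is the exponential of m times that
operator, and its commutator with the position is the rule stated here. *)
Lemma paths_derivation m p q : 0 < K -> p <= K -> q <= K ->
  (q - p) * paths (letters (m * K)) p q =
  m * p.+1 * paths (letters (m * K)) p.+1 q.
Proof.
move=> K0; elim: m p => [|j IH] p pK qK.
  by rewrite !mul0n /=; case: eqP => [->|]; rewrite ?subnn ?muln0.
rewrite !paths_period //; set F := paths (letters (j * K)) in IH *.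
have F0 x : q < x -> F x q = 0 by move=> lt; rewrite /F paths_lt ?letters_gt0.
rewrite big_distrr /=.
(* Write q - p = (q - x) + (x - p): the first part is the induction
   hypothesis, the second one is (x - p) C(x, p) = (p + 1) C(x, p + 1). *)
transitivity (\sum_(x < K.+1) (j * (p.+1 * ('C(x.+1, p.+1) * F x.+1 q)) +
                               p.+1 * ('C(x, p.+1) * F x q))).
  apply: eq_bigr => x _.
  rewrite [in X in _ + X]mulnA mul_bin_left.
  have -> : j * (p.+1 * ('C(x.+1, p.+1) * F x.+1 q)) = 'C(x, p) * ((q - x) * F x q).
    rewrite IH //; last by have := ltn_ord x; lia.
    rewrite [p.+1 * (_ * _)]mulnA -mul_bin_diag /=.
    by move: (F _ _) => f; move: 'C(x, p) => u; nia.
  have [lt|le] := ltnP q x; first by rewrite F0 // !muln0.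
  have [lt|le2] := ltnP x p; first by rewrite bin_small // !muln0.
  nia.
rewrite big_split /= -!big_distrr /=.
have -> : \sum_(x < K.+1) 'C(x.+1, p.+1) * F x.+1 q =
          \sum_(x < K.+1) 'C(x, p.+1) * F x q.
  rewrite [RHS]big_ord_recl bin0n mul0n add0n [LHS]big_ord_recr /=.
  by rewrite F0 ?muln0 ?addn0 // ltnS.
  by rewrite -mulnA mulSn addnC.
by lia.
Qed.
End Word.

(** * Ratios and the order on keys *)

Section Keys.
Local Open Scope nat_scope.
Variable K : nat.
(** The rank T of a key, see block. *)
Definition level (k : nat * nat) : nat := k.1 %/ k.2 * K + k.1 %% k.2.

Definition prec : rel (nat * nat) := fun k1 k2 =>
  (level k2 < level k1) || (level k1 == level k2) && (k1.2 < k2.2).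

Lemma prec_irr : irreflexive prec.
Proof. by move=> k; rewrite /prec !ltnn andbF. Qed.

Lemma prec_trans : transitive prec.
Proof. by move=> k2 k1 k3; rewrite /prec; lia. Qed.

Hypothesis K_gt0 : 0 < K.

Lemma level_block T k : k \in block K T -> level k = T /\ 0 < k.2 <= K.
Proof.
case/mapP => c; rewrite mem_iota => hc ->; rewrite /level /=.
have hT : T %% K < K by rewrite ltn_pmod.
have c0 : 0 < c by lia.
have lt : T %% K < c by lia.
rewrite divnMDl // modnMDl (divn_small lt) (modn_small lt) addn0 -divn_eq.
by split=> //; lia.
Qed.

Lemma mem_block T l c : 0 < c <= K -> level (l, c) = T -> (l, c) \in block K T.
Proof.
rewrite /level /= => /andP[c0 cK] E.
have hc : l %% c < c by rewrite ltn_pmod.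
have lt : l %% c < K by lia.
have E1 : T %/ K = l %/ c by rewrite -E divnMDl // (divn_small lt) addn0.
have E2 : T %% K = l %% c by rewrite -E modnMDl (modn_small lt).
apply/mapP; exists c; first by rewrite mem_iota E2; lia.
by rewrite E1 E2 -divn_eq.
Qed.

Lemma mem_word B l c :
  ((l, c) \in word K B) = (0 < c <= K) && (level (l, c) < B).
Proof.
elim: B => [|B IH]; first by rewrite andbF.
rewrite /= mem_cat IH ltnS [level _ <= B]leq_eqVlt andb_orr; congr (_ || _).
apply/idP/idP => [/level_block[-> ->]|/andP[hc /eqP]]; first by rewrite eqxx.
exact: mem_block.
Qed.

Lemma pairwise_word B : pairwise prec (word K B).
Proof.
elim: B => //= B IH; rewrite pairwise_cat IH andbT; apply/andP; split.
  apply/allrelP => x [l c] /level_block[xB _]; rewrite mem_word => /andP[_ lt].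
  by rewrite /prec xB lt.
have: pairwise ltn (iota (B %% K).+1 (K - B %% K)).
  by rewrite -sorted_pairwise ?iota_ltn_sorted //; apply: ltn_trans.
rewrite /block pairwise_map.
apply: (sub_in_pairwise _ (allss (iota (B %% K).+1 (K - B %% K)))).
move=> c d ic id lt.
have /level_block[/= E1 _] := map_f (fun c => (B %/ K * c + B %% K, c)) ic.
have /level_block[/= E2 _] := map_f (fun c => (B %/ K * c + B %% K, c)) id.
by rewrite /prec E1 E2 eqxx; apply/orP; right.
Qed.

Lemma level_lt m l c : 0 < c <= K -> (level (l, c) < m * K) = (l < m * c).
Proof.
rewrite /level /= => /andP[c0 cK]; have hc : l %% c < c by rewrite ltn_pmod.
have lt : l %% c < K by lia.
rewrite -(@ltn_divLR _ _ K) // -(@ltn_divLR _ _ c) // divnMDl //.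
by rewrite (divn_small lt) addn0.
Qed.

(** Along a row the key order expresses the weak inequality of ratios, and, in the
next lemma, down a column the strict one: quotients are compared first, and
when they agree, s1 / c against s2 / (c + 1) is decided by s1 and s2 alone
since both are smaller than their denominators. *)
Lemma prec_right l1 l2 c : 0 < c -> c < K ->
  prec (l1, c) (l2, c.+1) = (l2 * c <= l1 * c.+1).
Proof.
move=> c0 cK; rewrite /prec /= ltnSn andbT orbC [_ == _]eq_sym -leq_eqVlt.
rewrite /level /=.
rewrite {3}(divn_eq l1 c) {3}(divn_eq l2 c.+1).
have := ltn_pmod l1 c0; have := ltn_pmod l2 (ltn0Sn c).
move: (l1 %/ c) (l1 %% c) (l2 %/ c.+1) (l2 %% c.+1) => q1 s1 q2 s2 h2 h1.
case: (ltngtP q1 q2) => [lt|lt|->].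
- have [d ->] : exists d, q2 = q1 + d.+1 by exists (q2 - q1).-1; lia.
  apply/idP/idP; nia.
- have [d ->] : exists d, q1 = q2 + d.+1 by exists (q1 - q2).-1; lia.
  apply/idP/idP; nia.
by apply/idP/idP; nia.
Qed.

Lemma prec_down l1 l2 c : 0 < c -> c < K ->
  prec (l1, c.+1) (l2, c) = (l2 * c.+1 < l1 * c).
Proof.
move=> c0 cK; rewrite /prec /= [c.+1 < c]ltnNge leqW // andbF orbF /level /=.
rewrite {3}(divn_eq l1 c.+1) {3}(divn_eq l2 c).
have := ltn_pmod l2 c0; have := ltn_pmod l1 (ltn0Sn c).
move: (l2 %/ c) (l2 %% c) (l1 %/ c.+1) (l1 %% c.+1) => q1 s1 q2 s2 h2 h1.
case: (ltngtP q1 q2) => [lt|lt|->].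
- have [d ->] : exists d, q2 = q1 + d.+1 by exists (q2 - q1).-1; lia.
  apply/idP/idP; nia.
- have [d ->] : exists d, q1 = q2 + d.+1 by exists (q1 - q2).-1; lia.
  apply/idP/idP; nia.
by apply/idP/idP; nia.
Qed.
End Keys.

(** * Tableaux as subwords *)

Section Cells.
Local Open Scope nat_scope.
Variables (n r d : nat).
Notation box := ('I_r * 'I_d)%type.
Implicit Types (x y : box) (a l : config r).

(** n + content, the site that a particle enters when the cell is added. *)
Definition letter x : nat := n + x.2 - x.1.

Definition ground a : Prop := forall i : 'I_r, n - i.+1 <= a i.

Definition in_box a : Prop := forall i : 'I_r, a i <= n - i.+1 + d.

Definition fits x a l : bool := a x.1 < letter x <= l x.1.

Lemma ground_swapc c a : 0 < c -> can_hop c a -> ground a -> ground (swapc c a).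
Proof.
move=> c0 /andP[_ nc] ga i; rewrite ffunE /swap.
rewrite (_ : (a i == c) = false); first by have := ga i; case: eqP; lia.
by apply/eqP => E; case/occupiedP: nc; exists i.
Qed.

Hypothesis le_rn : r <= n.

Lemma letterE x : (letter x)%:Z = (n%:Z + x.2%:Z - x.1%:Z)%R.
Proof. by rewrite /letter; have := ltn_ord x.1; lia. Qed.

Lemma cell_of_letter l (i : 'I_r) c : in_box l -> n - i.+1 < c -> c <= l i ->
  exists2 x, x.1 = i & letter x = c.
Proof.
move=> bl lt le; have := bl i; have := ltn_ord i => hi hb.
have hj : c + i - n < d by lia.
by exists (i, Ordinal hj) => //; rewrite /letter /=; lia.
Qed.

Lemma letter_inj x y : x.1 = y.1 -> letter x = letter y -> x = y.
Proof.
case: x y => [i j] [i' j'] /= <-; rewrite /letter /= => E.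
by congr (_, _); apply: val_inj => /=; have := ltn_ord i; lia.
Qed.

Section Enumeration.
Variable l : config r.
Hypotheses (sl : strict l) (bl : in_box l).

(** The cell that is added when the letter c moves a particle of a. *)
Definition hit (c : nat) a y : bool := (letter y == c) && (a y.1 == c.-1).

Definition put (k : nat * nat) a (L : {ffun box -> nat}) : {ffun box -> nat} :=
  [ffun y => if hit k.2 a y then k.1 else L y].

(** The lecture hall tableaux on the cells between a and l, extended by 0: the
first key of the word either is not used, or fills the next cell of its
diagonal. *)
Fixpoint tableaux (w : seq (nat * nat)) a : seq {ffun box -> nat} :=
  if w is k :: w' then
    tableaux w' a ++
    (if can_hop k.2 a && below (swapc k.2 a) l then
       [seq put k a L | L <- tableaux w' (swapc k.2 a)] else [::])
  else if a == l then [:: [ffun=> 0]] else [::].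

Definition adjacent x y : bool :=
  (y.1 == x.1 :> nat) && (y.2 == x.2.+1 :> nat) ||
  (y.1 == x.1.+1 :> nat) && (y.2 == x.2 :> nat).

Variable R : rel (nat * nat).
Hypotheses (R_irr : irreflexive R) (R_trans : transitive R).

Definition tableau (w : seq (nat * nat)) a (L : {ffun box -> nat}) : Prop :=
  [/\ forall x, ~~ fits x a l -> L x = 0,
      forall x, fits x a l -> (L x, letter x) \in w
    & forall x y, fits x a l -> fits y a l -> adjacent x y ->
        R (L x, letter x) (L y, letter y)].

Lemma fits_swapc c a x : 0 < c -> strict a -> can_hop c a ->
  below (swapc c a) l -> fits x a l = fits x (swapc c a) l || hit c a x.
Proof.
move=> c0 sa /andP[/occupiedP[i Hi] nc] bs; rewrite /fits /hit ffunE /swap.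
have neq j : a j != c by apply: contraNneq nc => E; apply/occupiedP; exists j.
rewrite (negPf (neq _)); case: eqP => [E|_]; last by rewrite andbF orbF.
have : swapc c a x.1 <= l x.1 by apply: (forallP bs).
by rewrite ffunE /swap (negPf (neq _)) E eqxx; lia.
Qed.

Lemma hitNfits c a x : 0 < c -> can_hop c a -> hit c a x ->
  fits x (swapc c a) l = false.
Proof.
move=> c0 ch /andP[/eqP E /eqP E2]; rewrite /fits ffunE E2 swap_bot E.
by rewrite ltnn.
Qed.

Lemma hit_exists c a : 0 < c -> ground a -> can_hop c a ->
  below (swapc c a) l -> exists x, hit c a x.
Proof.
move=> c0 ga /andP[/occupiedP[i Hi] nc] bs.
have := forallP bs i; rewrite ffunE Hi swap_bot => le.
have [|x E1 E2] := @cell_of_letter l i c bl _ le.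
  by have := ga i; lia.
by exists x; rewrite /hit E1 E2 Hi !eqxx.
Qed.

(** A cell to the left of or above x inside the skew shape would carry a smaller
key, and there is none. So x is the next cell of its diagonal. *)
Lemma first_key_addable w k a L x : strict a -> ground a -> below a l ->
  all (R k) w -> 0 < k.2 -> tableau (k :: w) a L ->
  fits x a l -> (L x, letter x) = k -> hit k.2 a x && can_hop k.2 a.
Proof.
move=> sa ga ba /allP kw k0 [_ Lw LR] fx kx.
have first y : adjacent y x -> fits y a l = false.
  move=> yx; apply/negP => fy; have := LR _ _ fy fx yx; rewrite kx.
  have := Lw y fy; rewrite inE => /orP[/eqP->|/kw Rk Rk2]; first by rewrite R_irr.
  by have := R_trans Rk Rk2; rewrite R_irr.
have Ec : letter x = k.2 by rewrite -kx.
have /andP[lt le] := fx.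
have Ea : a x.1 = k.2.-1.
  case: (ltngtP (a x.1) k.2.-1) => // lt2; last by lia.
  have := ga x.1; have := ltn_ord x.1; have := ltn_ord x.2.
  rewrite /letter in Ec le * => h1 h2 h3.
  have hj : x.2.-1 < d by lia.
  have adj : adjacent (x.1, Ordinal hj) x by rewrite /adjacent /=; lia.
  by have := first _ adj; rewrite /fits /letter /=; lia.
rewrite /hit Ec Ea !eqxx /can_hop /=; apply/andP; split.
  by apply/occupiedP; exists x.1.
apply/occupiedP => -[i Hi].
have ltx : i < x.1.
  by rewrite ltnNge; apply/negP => /(strict_le sa); lia.
have hi : x.1.-1 < r by have := ltn_ord x.1; lia.
have adj : adjacent (Ordinal hi, x.2) x by rewrite /adjacent /=; lia.
have := first _ adj; rewrite /fits /letter /=.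
have := @strict_le r a i (Ordinal hi) sa; have := sl (i := Ordinal hi) (k := x.1).
rewrite /letter /= in Ec le *; have := ltn_ord x.1; lia.
Qed.

(** A tableau increasing for R is the same as a subword of w along which boxes are
added: the cell carrying the first key of w must be addable, and there is at
most one addable cell on each diagonal. *)
Lemma tableauxP w a L : all (leq 1) [seq k.2 | k <- w] -> pairwise R w ->
  strict a -> ground a -> below a l ->
  reflect (tableau w a L) (L \in tableaux w a).
Proof.
elim: w a L => [|k w IH] a L /=.
  move=> _ _ sa ga ba; apply: (iffP idP).
    case: eqP => // -> /[!inE] /eqP ->.
    have nf x : fits x l l = false by rewrite /fits; lia.
    by split=> [x _|x|x y]; rewrite ?ffunE ?nf.
  case=> L0 Lw _; have -> : a = l.
    apply/ffunP => i; apply/eqP; rewrite eqn_leq (forallP ba) leqNgt /=.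
    apply/negP => lt; have [|x E1 E2] := @cell_of_letter l i (l i) bl _ (leqnn _).
      by have := ga i; lia.
    by have /Lw : fits x a l by rewrite /fits E1 E2 lt leqnn.
  by rewrite eqxx inE; apply/eqP/ffunP => x; rewrite ffunE L0 //; apply/negP => /Lw.
move=> /andP[k0 w0] /andP[kw pw] sa ga ba.
set a' := swapc k.2 a.
rewrite mem_cat; apply: (iffP orP).
  case=> [/IH[]// L0 Lw LR|].
    by split=> // x fx; rewrite inE Lw ?orbT.
  case: ifP => // /andP[ch bs] /mapP[L' /IH[]//].
  - exact: strict_swapc.
  - exact: ground_swapc.
  move=> L0 Lw LR ->.
  have fE x := fits_swapc x k0 sa ch bs.
  have hN x := @hitNfits k.2 a x k0 ch.
  split=> [x|x|x y]; rewrite ?fE /put ?ffunE.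
  - by rewrite negb_or => /andP[/L0 -> /negPf->].
  - case: ifP => [/andP[/eqP-> _] _|_ /orP[/Lw|//]]; rewrite inE.
      by rewrite -surjective_pairing eqxx.
    by move=> ->; rewrite orbT.
  case: (boolP (hit _ _ y)) => hy.
    move=> fx _ xy; exfalso.
    have /andP[/eqP Ey /eqP Ay] := hy.
    move: ch => /andP[_ /occupiedP nc].
    have : fits x a l by rewrite fE.
    rewrite /fits; case/orP: xy => /andP[/eqP E1 /eqP E2].
      have E1' : y.1 = x.1 by apply: val_inj.
      rewrite -E1' Ay.
      by move: Ey; rewrite /letter E1 E2; have := ltn_ord x.1; lia.
    have lt : x.1 < y.1 by lia.
    have := sa _ _ lt; rewrite Ay => lta.
    have nea : a x.1 <> k.2 by move=> E; apply: nc; exists x.1.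
    by move: Ey; rewrite /letter E1 E2; have := ltn_ord x.1; have := ltn_ord y.1; lia.
  case: (boolP (hit _ _ x)) => hx.
    move=> _ /orP[/Lw fy _|//].
    case/andP: hx => /eqP-> _; rewrite -surjective_pairing.
    exact: (allP kw).
  by rewrite !orbF; apply: LR.
move=> T; have [L0 Lw LR] := T.
have fk := first_key_addable sa ga ba kw k0 T.
have [/existsP[x /andP[fx /eqP kx]]|/existsPn no] :=
  boolP [exists x, fits x a l && ((L x, letter x) == k)]; last first.
  left; apply/IH => //; split=> // x fx.
  by have := no x; have := Lw x fx; rewrite inE fx /= => /orP[->|].
right; have /andP[hx ch] := fk x fx kx.
have bs : below a' l.
  apply/forallP => i; rewrite ffunE /swap.
  have -> : (a i == k.2) = false.
    by apply/eqP => E; case/andP: ch => _ /occupiedP[]; exists i.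
  case: eqP => [E|_]; last exact: (forallP ba).
  have -> : i = x.1.
    by apply: (strict_inj sa); rewrite E; case/andP: hx => _ /eqP.
  by case/andP: fx; case/andP: hx => /eqP->.
rewrite ch bs /=; apply/mapP.
exists [ffun y => if hit k.2 a y then 0 else L y].
  have fE y := fits_swapc y k0 sa ch bs.
  have hN y := @hitNfits k.2 a y k0 ch.
  apply/IH => //; [exact: strict_swapc|exact: ground_swapc|split].
  - move=> y nf; rewrite ffunE; case: ifPn => // nh; apply: L0.
    by rewrite fE negb_or nf.
  - move=> y fy; rewrite ffunE; case: ifPn => [/hN|nh]; first by rewrite fy.
    have fy' : fits y a l by rewrite fE fy.
    have := Lw y fy'; rewrite inE => /orP[/eqP Ek|//].
    by have := fk y fy' Ek; rewrite (negPf nh).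
  move=> y z fy fz yz; rewrite !ffunE.
  case: ifPn => [/hN|_]; first by rewrite fy.
  case: ifPn => [/hN|_]; first by rewrite fz.
  by apply: LR => //; rewrite fE ?fy ?fz.
apply/ffunP => y; rewrite !ffunE; case: ifPn => [hy|/negPf->//].
have -> : y = x; last by rewrite -kx.
move: hx hy => /andP[/eqP E1 /eqP E2] /andP[/eqP E3 /eqP E4].
by apply: letter_inj; rewrite ?E1 ?E3 //; apply: (strict_inj sa); rewrite E4 E2.
Qed.

Lemma tableaux_uniq w a : all (leq 1) [seq k.2 | k <- w] -> pairwise R w ->
  strict a -> ground a -> below a l -> uniq (tableaux w a).
Proof.
elim: w a => [|k w IH] a /=; first by case: eqP.
move=> /andP[k0 w0] /andP[kw pw] sa ga ba.
rewrite cat_uniq IH //=; case: ifP => // /andP[ch bs].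
have sa' := strict_swapc k0 sa ch; have ga' := ground_swapc k0 ch ga.
have fE y := fits_swapc y k0 sa ch bs.
have hN y := @hitNfits k.2 a y k0 ch.
rewrite map_inj_in_uniq ?IH ?andbT //.
  apply/hasPn => _ /mapP[L' _ ->]; apply/negP => /tableauxP[]// _ Lw _.
  (* The cell hit carries the first key, which occurs only once in the word. *)
  have [x hx] := hit_exists k0 ga ch bs.
  have := Lw x; rewrite fE hx orbT ffunE hx => /(_ isT).
  case/andP: hx => /eqP-> _; rewrite -surjective_pairing => /(allP kw).
  by rewrite R_irr.
move=> L1 L2 /tableauxP[]// L01 _ _ /tableauxP[]// L02 _ _ /ffunP E.
apply/ffunP => x; have := E x; rewrite !ffunE; case: ifP => // hx _.
by rewrite L01 ?hN // L02 ?hN.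
Qed.

(** The recursion of the enumeration is that of the path determinant. *)
Lemma size_tableaux (S : comNzRingType) w a :
  all (leq 1) [seq k.2 | k <- w] -> strict a -> below a l ->
  (size (tableaux w a))%:R = \det (path_mx S [seq k.2 | k <- w] a l) :> S.
Proof.
elim: w a => [|k w IH] a /=.
  by move=> _ sa ba; rewrite det_path_nil //; case: eqP.
move=> /andP[k0 w0] sa ba; rewrite det_path_cons //; last exact: strict_inj.
rewrite size_cat natrD IH //; congr (_ + _)%R.
case ch: (can_hop _ _) => //=; have sa' := strict_swapc k0 sa ch.
by case: ifPn => bs; rewrite ?size_map ?IH // det_path_nbelow.
Qed.

End Enumeration.
End Cells.

(** * Subsets of cells as words *)

Section Reading.
Local Open Scope nat_scope.
Variables (r d : nat).
Notation box := ('I_r * 'I_d)%type.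
Implicit Types (x y z : box) (D : {set box}).

Definition before x y : bool := (x.1 < y.1) || (x.1 == y.1 :> nat) && (x.2 < y.2).

(** Row by row from the last cell to the first, since words act from their end. *)
Definition all_cells : seq box := rev [seq (i, j) | i <- enum 'I_r, j <- enum 'I_d].

Definition reading D : seq box := [seq x <- all_cells | x \in D].

Lemma mem_all_cells x : x \in all_cells.
Proof.
case: x => i j; rewrite mem_rev; apply/allpairsP.
by exists (i, j); rewrite !mem_enum.
Qed.

Lemma mem_reading D x : (x \in reading D) = (x \in D).
Proof. by rewrite mem_filter mem_all_cells andbT. Qed.

Lemma pairwise_enum_ord k : pairwise (fun i j : 'I_k => i < j) (enum 'I_k).
Proof.
have := iota_ltn_sorted 0 k; rewrite sorted_pairwise; last exact: ltn_trans.
by rewrite -val_enum_ord pairwise_map.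
Qed.

Lemma pairwise_all_cells : pairwise (fun x y => before y x) all_cells.
Proof.
have tr : transitive before by move=> y x z; rewrite /before; lia.
rewrite -sorted_pairwise; last by move=> y x z yx zy; apply: tr zy yx.
rewrite rev_sorted sorted_pairwise //.
elim: (enum 'I_r) (pairwise_enum_ord r) => // i s IH /= /andP[/allP is_ ps].
rewrite pairwise_cat IH // andbT; apply/andP; split.
  apply/allrelP => _ _ /mapP[j _ ->] /allpairsP[[k j'] [/= /is_ lt _ ->]].
  by rewrite /before /= lt.
rewrite pairwise_map; apply: sub_pairwise (pairwise_enum_ord d) => j j' lt.
by rewrite /before /= eqxx lt orbT.
Qed.

Lemma pairwise_reading D : pairwise (fun x y => before y x) (reading D).
Proof. exact: pairwise_filter pairwise_all_cells. Qed.

Lemma before_irr x : before x x = false.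
Proof. by rewrite /before !ltnn andbF. Qed.

Lemma pairwise_before_uniq (s : seq box) : pairwise (fun x y => before y x) s -> uniq s.
Proof. by apply: pairwise_uniq => x; rewrite before_irr. Qed.

End Reading.

Section Building.
Local Open Scope nat_scope.
Variables (n r d : nat).
Hypothesis le_rn : r <= n.
Notation box := ('I_r * 'I_d)%type.
Notation letter := (@letter n r d).
Implicit Types (x y z : box) (D : {set box}) (a : config r).

Definition hop c a : option (config r) :=
  if can_hop c a then Some (swapc c a) else None.

Definition empty_config : config r := [ffun i : 'I_r => n - i.+1].

Definition build (w : seq nat) : option (config r) :=
  foldr (fun c => obind (hop c)) (Some empty_config) w.

Lemma letter_gt0 x : 0 < letter x.
Proof. by rewrite /letter; have := ltn_ord x.1; lia. Qed.

Lemma hop_comm c e a : 0 < c -> 0 < e -> (c.+1 < e) || (e.+1 < c) ->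
  obind (hop c) (hop e a) = obind (hop e) (hop c a).
Proof.
move=> c0 e0 far; rewrite /hop.
have cc : can_hop c (swapc e a) = can_hop c a.
  by rewrite /can_hop !occupied_swapc !swap_id //; lia.
have ce : can_hop e (swapc c a) = can_hop e a.
  by rewrite /can_hop !occupied_swapc !swap_id //; lia.
case hc: (can_hop c a); case he: (can_hop e a); rewrite /= /hop ?cc ?ce ?hc ?he //.
by rewrite swapc_comm //; lia.
Qed.

(** Letters that differ by at least two act on disjoint pairs of sites. *)
Lemma build_slide c v w : 0 < c -> all (leq 1) v ->
  all (fun e => (c.+1 < e) || (e.+1 < c)) v ->
  build (c :: v ++ w) = build (v ++ c :: w).
Proof.
move=> c0; elim: v => //= e v IH /andP[e0 v0] /andP[far fv].
rewrite -IH //=; case: (build (v ++ w)) => //= a.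
exact: hop_comm.
Qed.

Lemma build_cat u v w : build v = build w -> build (u ++ v) = build (u ++ w).
Proof. by elim: u => //= c u IH /IH ->. Qed.

(** The cells read strictly between x and its diagonal successor y, other than the
two corners that an excited move requires to be empty, lie at least two
diagonals away from x. *)
Lemma letter_far x y z : y.1 = x.1.+1 :> nat -> y.2 = x.2.+1 :> nat ->
  before x z -> before z y -> z != (x.1, y.2) -> z != (y.1, x.2) ->
  ((letter x).+1 < letter z) || ((letter z).+1 < letter x).
Proof.
case: x y z => [i j] [i' j'] [k m] /= E1 E2; rewrite /before /letter /=.
rewrite !xpair_eqE -!val_eqE /= E1 E2.
by have := ltn_ord i'; have := ltn_ord k; lia.
Qed.

(** An excited move pushes one letter of the reading word past letters that commute
with it, so the diagram that is built does not change. *)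
Lemma build_move D x y : x \in D -> y \notin D ->
  y.1 = x.1.+1 :> nat -> y.2 = x.2.+1 :> nat ->
  (x.1, y.2) \notin D -> (y.1, x.2) \notin D ->
  build (map letter (reading (y |: (D :\ x)))) = build (map letter (reading D)).
Proof.
move=> xD yD E1 E2 n1 n2; rewrite /reading.
have pw := pairwise_all_cells r d; have un := pairwise_before_uniq pw.
have : x \in all_cells r d by exact: mem_all_cells.
have yall : y \in all_cells r d by exact: mem_all_cells.
move: pw un; case/splitPr: yall => A T pw un.
have bxy : before x y by rewrite /before E1 ltnSn.
rewrite mem_cat inE => /or3P[xA|/eqP Ex|xT].
- move: pw; rewrite pairwise_cat => /andP[/allrelP/(_ x y xA)].
  by rewrite mem_head => /(_ isT); rewrite /before E1; lia.
- by move: E2; rewrite Ex; lia.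
case/splitPr: xT pw un => B C pw un.
(* A, B and C are the cells after y, between x and y, and before x. *)
have ne z : z \in A ++ B ++ C -> (z != x) /\ (z != y).
  move=> zz; move: un; rewrite -cat_cons -cat_rcons.
  rewrite (perm_uniq (s2 := x :: y :: A ++ B ++ C)); last first.
    by apply/seq.permP => P; rewrite -?cats1 /= !count_cat /= !count_cat /=; lia.
  rewrite /= inE negb_or => /and3P[/andP[_ nx] ny _].
  by split; [apply: contraNneq nx|apply: contraNneq ny] => <-.
have eqf (s : seq box) : {subset s <= A ++ B ++ C} ->
    [seq z <- s | z \in y |: (D :\ x)] = [seq z <- s | z \in D].
  move=> sub; apply: eq_in_filter => z /sub/ne[nx ny].
  by rewrite !inE (negPf nx) (negPf ny).
rewrite !filter_cat /= !filter_cat /= !inE !eqxx /= (negPf yD) xD.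
have -> : (x == y) = false by apply/eqP => E; rewrite E in xD; rewrite xD in yD.
rewrite /= !eqf; try by move=> z zz; rewrite !mem_cat zz ?orbT.
rewrite !map_cat /= !map_cat; apply: build_cat.
have -> : letter y = letter x.
  by rewrite /letter E1 E2; have := ltn_ord y.1; lia.
apply: build_slide; first exact: letter_gt0.
  by apply/allP => _ /mapP[z _ ->]; apply: letter_gt0.
apply/allP => _ /mapP[z + ->]; rewrite mem_filter => /andP[zD zB].
move: pw; rewrite pairwise_cat => /and3P[_ _] /=; rewrite pairwise_cat => /and3P[].
move=> /allP/(_ z) + /allrelP/(_ z x zB) + _.
rewrite mem_cat zB mem_head => /(_ isT) + /(_ isT).
move=> zy xz; apply: letter_far E1 E2 xz zy _ _.
  by apply: contraNneq n1 => <-.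
by apply: contraNneq n2 => <-.
Qed.

Definition is_diagram a (s : seq box) : Prop :=
  [/\ strict a, ground n a, in_box n d a
    & forall x, (x \in s) = (letter x <= a x.1)].

Lemma is_diagram_empty : is_diagram empty_config [::].
Proof.
split=> [i k lt|i|i|x]; rewrite ?ffunE //.
- by have := ltn_ord k; lia.
- by rewrite leq_addr.
by rewrite in_nil /letter; have := ltn_ord x.1; lia.
Qed.

(** The box is added at the very cell that is read. *)
Lemma is_diagram_cons a s x : is_diagram a s -> a x.1 = (letter x).-1 ->
  can_hop (letter x) a -> is_diagram (swapc (letter x) a) (x :: s).
Proof.
move=> [sa ga ba sE] Ex ch; have x0 := letter_gt0 x.
have aE i : swapc (letter x) a i = if i == x.1 then letter x else a i.
  rewrite ffunE; case: eqP => [->|/eqP ne]; first by rewrite Ex swap_bot.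
  rewrite swap_id //; last by rewrite -Ex (inj_eq (strict_inj sa)).
  by case/andP: ch => _; apply: contraNneq => E; apply/occupiedP; exists i.
split; first exact: strict_swapc.
- exact: ground_swapc.
- move=> i; rewrite aE; case: eqP => [->|_]; last exact: ba.
  by rewrite /letter; have := ltn_ord x.1; have := ltn_ord x.2; lia.
move=> y; rewrite inE sE aE; case: (y =P x) => [->|ne]; first by rewrite eqxx leqnn.
case: eqP => [E|//]; rewrite E Ex.
have : letter y <> letter x by move=> /(letter_inj le_rn E).
by lia.
Qed.

(** An order ideal read row by row adds its own cells, one at a time. *)
Lemma closed_build (s : seq box) : pairwise (fun x y => before y x) s ->
  (forall x y, x \in s -> adjacent y x -> y \in s) ->
  exists2 a, build (map letter s) = Some a & is_diagram a s.
Proof.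
elim: s => [_ _|x s IH /= /andP[/allP bx pw] cl].
  by exists empty_config => //; apply: is_diagram_empty.
have xs : x \notin s by apply/negP => /bx; rewrite before_irr.
have adj_before y z : adjacent y z -> before y z by rewrite /adjacent /before; lia.
have sub y : y \in x :: s -> before y x -> y \in s.
  by rewrite inE => /orP[/eqP->|//]; rewrite before_irr.
have [|a -> da] := IH pw.
  move=> z y zs yz; have := cl z y; rewrite !inE zs orbT => /(_ isT yz).
  case/orP => // /eqP E; have := bx z zs; have := adj_before _ _ yz.
  by rewrite E /before; lia.
have [sa ga ba sE] := da.
have xa : a x.1 < letter x by rewrite ltnNge -sE.
have first y : adjacent y x -> letter y <= a y.1.
  move=> yx; rewrite -sE; apply: sub (adj_before _ _ yx).
  by apply: cl yx; rewrite mem_head.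
have Ex : a x.1 = (letter x).-1.
  have := ga x.1; have := ltn_ord x.1; have := ltn_ord x.2.
  rewrite /letter in xa first * => h1 h2 h3.
  have hj : x.2.-1 < d by lia.
  have [E0|x2] := posnP x.2; first by lia.
  have adj : adjacent (x.1, Ordinal hj) x by rewrite /adjacent /=; lia.
  by have := first _ adj; rewrite /=; lia.
have ch : can_hop (letter x) a.
  rewrite /can_hop -Ex; apply/andP; split; first by apply/occupiedP; exists x.1.
  apply/occupiedP => -[i Hi].
  have ltx : i < x.1.
    by rewrite ltnNge; apply/negP => /(strict_le sa); lia.
  have hi : x.1.-1 < r by have := ltn_ord x.1; lia.
  have adj : adjacent (Ordinal hi, x.2) x by rewrite /adjacent /=; lia.
  have := first _ adj; rewrite /letter /= in xa Hi *.
  by have := @strict_le r a i (Ordinal hi) sa; have := ltn_ord x.1; rewrite /=; lia.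
exists (swapc (letter x) a); first by rewrite /= /hop ch.
exact: is_diagram_cons.
Qed.

(** An excited move backwards is possible at x. *)
Definition retractable (s : seq box) x : bool :=
  [exists p : box, [&& x.1 == p.1.+1 :> nat, x.2 == p.2.+1 :> nat,
    p \notin s, (p.1, x.2) \notin s & (x.1, p.2) \notin s]].

(** Consider the first cell of s, in reading order, that adds a box at another
place than its own. All the cells before it form a genuine diagram that does
not contain the added box, hence none of the cells which would obstruct a
backward excited move. *)
Lemma build_diagram_or_retract (s : seq box) a :
  pairwise (fun x y => before y x) s ->
  build (map letter s) = Some a ->
  is_diagram a s \/ exists2 x, x \in s & retractable s x.
Proof.
elim: s a => [|x s IH] a /=.
  by move=> _ [<-]; left; apply: is_diagram_empty.
move=> /andP[/allP bx pw]; case Eb: (build _) => [a'|] //=.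
rewrite /hop; case: ifP => // ch [<-].
have xs : x \notin s by apply/negP => /bx; rewrite before_irr.
have notin y : y \notin s -> before y x -> y \notin x :: s.
  by move=> ys; rewrite inE (negPf ys) orbF; case: eqP => // ->; rewrite before_irr.
have [da|[z zs /existsP[p /and5P[/eqP p1 /eqP p2 n1 n2 n3]]]] := IH _ pw Eb; last first.
  right; exists z; first by rewrite inE zs orbT.
  have := bx z zs; rewrite /before => bz.
  by apply/existsP; exists p; rewrite p1 p2 !eqxx /= !notin // /before /=; lia.
have [sa ga ba sE] := da.
have xa : a' x.1 < letter x by rewrite ltnNge -sE.
have /andP[/occupiedP[i Hi] _] := ch.
case: (ltngtP i x.1) => [lt|lt|/val_inj E]; last first.
- by left; apply: is_diagram_cons => //; rewrite -E.
- by have := strict_le sa (ltnW lt); lia.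
right; exists x; first exact: mem_head.
have gi := ga i; have hx := ltn_ord x.1; have hx2 := ltn_ord x.2.
have hi : x.1.-1 < r by lia.
have hj : x.2.-1 < d by lia.
have li := strict_le sa (ltnW lt).
have li1 := @strict_le r a' i (Ordinal hi) sa.
have x2 : 0 < x.2 by move: Hi gi; rewrite /letter; lia.
(* The box was added strictly above x, so the diagram of a' misses the cell
   diagonally before x and the two cells next to it. *)
rewrite /letter in Hi xa.
apply/existsP; exists (Ordinal hi, Ordinal hj).
rewrite /= !prednK ?eqxx //=; last by lia.
by rewrite !notin // ?sE /letter /before /=; rewrite /= in li1; lia.
Qed.
End Building.

(** * Excited diagrams as subwords *)

Lemma nth_partition p i k : is_partition p -> (i <= k)%N ->
  (nth 0 p k <= nth 0 p i)%N.
Proof.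
move=> /andP[sp _] ik; case: (ltnP k (size p)) => [kp|kp].
  have tr : transitive geq by move=> a b c h1 h2; apply: leq_trans h2 h1.
  by apply: (sorted_leq_nth tr leqnn 0%N sp); rewrite ?inE //=; lia.
by rewrite nth_default.
Qed.

Section Rows.
Local Open Scope nat_scope.
Variables (n : nat) (la : seq nat).
Hypothesis hn : size la <= n.
Notation r := (size la).
Notation d := (head 0 la).
Notation letter := (@letter n r d).
Notation lam := (diagram la la).
Implicit Types (D : {set cell la}) (x y : cell la).

Definition rows (p : seq nat) : config r := [ffun i : 'I_r => n - i.+1 + nth 0 p i].

Lemma part_sub_nth mu i : part_sub mu la -> nth 0 mu i <= nth 0 la i.
Proof.
case E: (nth 0 mu i) => [//|k] /(_ i k); rewrite /in_diagram E ltnSn.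
exact.
Qed.

Lemma ground_rows p : ground n (rows p).
Proof. by move=> i; rewrite ffunE leq_addr. Qed.

Lemma strict_rows p : is_partition p -> strict (rows p).
Proof.
move=> hp i k ik; rewrite !ffunE.
by have := nth_partition hp (ltnW ik); have := ltn_ord k; lia.
Qed.

Lemma in_box_rows p : is_partition p -> part_sub p la -> in_box n d (rows p).
Proof.
move=> hp hs i; rewrite ffunE leq_add2l -[d]nth0.
by apply: leq_trans (part_sub_nth 0 hs); apply: nth_partition.
Qed.

Lemma is_diagram_unique a b (s s' : seq (cell la)) : s =i s' ->
  is_diagram n a s -> is_diagram n b s' -> a = b.
Proof.
move=> ss' [_ ga ba aE] [_ gb bb bE]; apply/ffunP => i.
case: (ltngtP (a i) (b i)) => // lt.
  have [|x E1 E2] := cell_of_letter hn bb _ (leqnn (b i)); first by have := ga i; lia.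
  by have := aE x; rewrite ss' bE E1 E2 leqnn leqNgt lt.
have [|x E1 E2] := cell_of_letter hn ba _ (leqnn (a i)); first by have := gb i; lia.
by have := bE x; rewrite -ss' aE E1 E2 leqnn leqNgt lt.
Qed.

Lemma mem_diagram_rows p x : (x \in diagram la p) = (letter x <= rows p x.1).
Proof.
by rewrite inE /in_diagram ffunE /letter; have := ltn_ord x.1; lia.
Qed.

Lemma is_diagram_rows p (s : seq (cell la)) : is_partition p -> part_sub p la ->
  s =i diagram la p -> is_diagram n (rows p) s.
Proof.
move=> hp hs sE; split=> [|||x].
- exact: strict_rows.
- exact: ground_rows.
- exact: in_box_rows.
by rewrite sE mem_diagram_rows.
Qed.

End Rows.

Section ExcitedWords.
Local Open Scope nat_scope.
Variables (n : nat) (la : seq nat).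
Hypotheses (hla : is_partition la) (hn : size la <= n).
Notation r := (size la).
Notation d := (head 0 la).
Notation letter := (@letter n r d).
Notation lam := (diagram la la).
Notation rows := (rows n la).
Implicit Types (D : {set cell la}) (x y : cell la).

Lemma diagram_closed p x y : is_partition p ->
  x \in diagram la p -> y.1 <= x.1 -> y.2 <= x.2 -> y \in diagram la p.
Proof.
move=> hp; rewrite !inE /in_diagram => xp h1 h2.
by apply: leq_trans (nth_partition hp h1); apply: leq_ltn_trans xp.
Qed.

Lemma build_diagram p : is_partition p -> part_sub p la ->
  build n r (map letter (reading (diagram la p))) = Some (rows p).
Proof.
move=> hp hs; have [|a -> da] := closed_build hn (pairwise_reading (diagram la p)).
  move=> x y; rewrite !mem_reading => xp adj.
  by apply: diagram_closed hp xp _ _; move: adj; rewrite /adjacent; lia.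
congr Some; apply: (is_diagram_unique hn (frefl _) da (is_diagram_rows hn hp hs _)).
exact: mem_reading.
Qed.

Lemma retract_move D x : D \subset lam -> x \in D -> retractable (reading D) x ->
  exists D', [/\ D' \subset lam, excited_move D' D,
    build n r (map letter (reading D')) = build n r (map letter (reading D)) &
    \sum_(y in D') y.1 < \sum_(y in D) y.1].
Proof.
move=> Dl xD /existsP[p /and5P[/eqP E1 /eqP E2]]; rewrite !mem_reading => n1 n2 n3.
have xl := fintype.subsetP Dl x xD.
have xp : (x == p) = false by apply/eqP => E; rewrite E in E1; lia.
pose D' := p |: (D :\ x).
have D'E y : (y \in D') = (y == p) || (y != x) && (y \in D) by rewrite !inE.
have DE : D = x |: (D' :\ p).
  apply/setP => y; rewrite !inE; have [->|nx] := eqVneq y x; first by rewrite xD.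
  by have [->|] := eqVneq y p; rewrite //= (negPf n1).
have n2' : (p.1, x.2) \notin D'.
  rewrite D'E (negPf n2) andbF orbF -pair_eqE /pair_eq -!val_eqE /= E2.
  by rewrite (gtn_eqF (ltnSn _)) andbF.
have n3' : (x.1, p.2) \notin D'.
  rewrite D'E (negPf n3) andbF orbF -pair_eqE /pair_eq -!val_eqE /= E1.
  by rewrite (gtn_eqF (ltnSn _)).
have xD' : x \notin D' by rewrite D'E xp eqxx.
exists D'; split.
- apply/fintype.subsetP => y; rewrite D'E => /orP[/eqP->|/andP[_ /(fintype.subsetP Dl)//]].
  by rewrite (diagram_closed hla xl) ?E1 ?E2 ?leqnSn.
- apply/existsP; exists p; apply/existsP; exists x.
  rewrite D'E eqxx E1 E2 !eqxx -DE eqxx andbT /=.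
  by rewrite !finset.in_setD n2' n3' xD' xl !(diagram_closed hla xl) //= ?E1 ?E2.
- rewrite [in RHS]DE (build_move hn _ xD' E1 E2) //; last by rewrite D'E eqxx.
rewrite (big_setD1 _ xD) /= big_setU1 /=; last by rewrite !inE (negPf n1) andbF.
by rewrite ltn_add2r E1.
Qed.

(** Backward excited moves lower the row indices, so they end at a set to which
build_diagram_or_retract allows no further move: a genuine diagram. *)
Lemma build_excited D a : D \subset lam ->
  build n r (map letter (reading D)) = Some a ->
  exists D0, [/\ D0 \subset lam, connect (@excited_move la) D0 D &
    is_diagram n a (reading D0)].
Proof.
have [e] := ubnP (\sum_(y in D) y.1); elim: e D => // e IH D lt Dl bD.
have [da|[x xD rx]] := build_diagram_or_retract hn (pairwise_reading D) bD.
  by exists D; split.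
rewrite mem_reading in xD.
have [D' [D'l mv bE lt']] := retract_move Dl xD rx.
have [||D0 [D0l cn d0]] := IH D' _ D'l; first by lia.
  by rewrite bE.
by exists D0; split=> //; apply: connect_trans cn (connect1 mv).
Qed.

(** Excited diagrams of mu are the reduced subwords of the reading word of la that
build mu. *)
Lemma excitedP mu D : is_partition mu -> part_sub mu la ->
  excited mu D =
  (D \subset lam) && (build n r (map letter (reading D)) == Some (rows mu)).
Proof.
move=> hmu hs; have mul : diagram la mu \subset lam.
  apply/fintype.subsetP => x; rewrite !inE; exact: hs.
apply/idP/andP.
  case/connectP => s ps ->; elim/last_ind: s ps => [|s E IH] /=.
    by rewrite build_diagram.
  rewrite rcons_path last_rcons => /andP[/IH[]]; set D1 := last _ s => D1l /eqP bD1.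
  case/existsP => x /existsP[y /and5P[xD /eqP E1 /eqP E2]].
  rewrite !finset.in_setD => /andP[n1 _] /and3P[/andP[n2 _] /andP[yD yl] /eqP ->].
  rewrite build_move // bD1 eqxx; split=> //.
  apply/fintype.subsetP => z; rewrite !inE => /orP[/eqP->|/andP[_ /(fintype.subsetP D1l)]].
    by move: yl; rewrite inE.
  by rewrite inE.
case=> Dl /eqP bD; have [D0 [D0l cn d0]] := build_excited Dl bD.
suff E : D0 = diagram la mu by rewrite /excited -E.
case: d0 => _ _ _ d0; apply/setP => x.
by rewrite (mem_diagram_rows hn) -d0 mem_reading.
Qed.
End ExcitedWords.

(** * Sums over subwords of a reading word *)

Definition swaps (w : seq nat) (p : nat) : nat := foldr swap p w.

(** The letters of one full row: the particle of the row goes to its end, and each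
site that it passes is shifted back by one. *)
Lemma swaps_rev_iota s m p : (0 < s)%N ->
  swaps (rev (iota s m)) p =
  (if p == s.-1 then s.-1 + m else if s <= p < s + m then p.-1 else p)%N.
Proof.
move=> s0; elim: m => [|m IH].
  by rewrite /=; repeat (case: ifP => ?); lia.
rewrite -[m.+1]addn1 iotaD rev_cat /= IH.
case: eqP => [E|ne]; first by rewrite /swap; repeat (case: ifP => ?); lia.
by case: (boolP (s <= p < s + m)%N) => h1; rewrite /swap; repeat (case: ifP => ?); lia.
Qed.

Section Weights.
Variable R : comNzRingType.

Fixpoint letter_weight (t : nat -> R) (w : seq nat) (c : nat) : R :=
  if w is e :: w' then
    if c == e then t e - t e.-1 else letter_weight (t \o swap e) w' c
  else 0.

(** Inside a row, the later letters move the particle to the end of the row and do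
not touch the site that it has left. *)
Lemma letter_weight_rev_iota t s m c : (0 < s)%N -> (s <= c < s + m)%N ->
  letter_weight t (rev (iota s m)) c = t (s + m).-1 - t c.-1.
Proof.
move=> s0; elim: m t => [|m IH] t; first by lia.
rewrite -[m.+1]addn1 iotaD rev_cat /= => hc.
case: eqP => [->|ne]; first by rewrite addn1 addnS.
rewrite IH; last by lia.
rewrite /= swap_bot swap_id; try lia.
by rewrite addn1 addnS.
Qed.

Lemma total_foldl_swap r (t : nat -> R) w (a : config r) :
  total (foldl (fun u c => u \o swap c) t w) a =
  \sum_i t (swaps w (a i)).
Proof.
apply: eq_bigr => i _; elim: w t => //= c w IH t; by rewrite IH.
Qed.

Variables (n r d : nat).
Hypothesis le_rn : (r <= n)%N.
Notation box := ('I_r * 'I_d)%type.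
Notation letter := (@letter n r d).
Implicit Types (x y : box) (D : {set box}) (a : config r).

Fixpoint cell_weight (t : nat -> R) (s : seq box) x : R :=
  if s is z :: s' then
    if x == z then t (letter z) - t (letter z).-1
    else cell_weight (t \o swap (letter z)) s' x
  else 0.

Lemma cell_weight_cat t s1 s2 x : x \notin s1 ->
  cell_weight t (s1 ++ s2) x = cell_weight (t \o swaps (map letter s1)) s2 x.
Proof.
elim: s1 t => [|z s1 IH] t //=; rewrite inE negb_or => /andP[/negPf-> /IH->].
by [].
Qed.

Lemma cell_weight_letter t s1 s2 x : x \in s1 ->
  {in s1 &, injective letter} ->
  cell_weight t (s1 ++ s2) x = letter_weight t (map letter s1) (letter x).
Proof.
elim: s1 t => [|z s1 IH] t //= xs inj.
have -> : (x == z) = (letter x == letter z).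
  by apply/eqP/eqP => [->|/inj]//; apply; rewrite ?mem_head.
case: eqP => [//|ne].
apply: IH; first by move: xs; rewrite inE => /orP[/eqP E|//]; rewrite E in ne.
by move=> u v us vs; apply: inj; rewrite inE ?us ?vs orbT.
Qed.

Lemma obind_hop_eq_some c (o : option (config r)) a : (0 < c)%N ->
  (obind (hop c) o == Some a) = can_unhop c a && (o == Some (swapc c a)).
Proof.
move=> c0; case: o => [b|]; last by rewrite andbF.
rewrite /= /hop; case: ifPn => ch; last first.
  apply/esym/negbTE; apply: contraNN ch => /andP[cu /eqP[->]].
  by rewrite can_hop_swapc.
apply/eqP/andP => [[<-]|[_ /eqP[->]]]; last by rewrite swapcK.
by rewrite can_unhop_swapc swapcK ch.
Qed.

(** The subsets of s that build a, weighted cell by cell, satisfy the recursion of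
subword_sum on the first cell of s. *)
Lemma sum_subwords (s : seq box) t a : uniq s ->
  \sum_(D : {set box} | (D \subset s) &&
       (build n r (map letter [seq x <- s | x \in D]) == Some a))
     \prod_(x in D) cell_weight t s x =
  subword_sum (empty_config n r) t (map letter s) a.
Proof.
elim: s t a => [|z s IH] t a /=.
  move=> _; rewrite big_mkcond (bigD1 finset.set0) //= big_set0 big1 => [|D ne].
    rewrite addr0 (_ : (finset.set0 \subset [::]) = true).
      by rewrite -[Some _ == _]/(_ == a) eq_sym; case: eqP.
    by apply/fintype.subsetP => x; rewrite !inE.
  case: ifP => // /andP[/fintype.subsetP sub _].
  by case/finset.set0Pn: ne => x /sub.
move=> /andP[zs us]; rewrite (bigID (fun D : {set box} => z \in D)) /= addrC.
congr (_ + _).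
  rewrite -IH //; apply: eq_big => D.
    case zD: (z \in D); rewrite ?andbT ?andbF /=.
      apply/esym/negbTE/negP => /andP[/fintype.subsetP/(_ z zD)].
      by rewrite (negPf zs).
    congr (_ && _); apply/fintype.subsetP/fintype.subsetP => sub x xD.
      by have := sub x xD; rewrite inE; case: eqP => // E; rewrite -E xD in zD.
    by rewrite inE sub ?orbT.
  move=> /andP[_ zD]; apply: eq_bigr => x xD.
  by case: eqP => // E; rewrite -E xD in zD.
rewrite (reindex_onto (fun D : {set box} => z |: D) (fun D => D :\ z)) /=; last first.
  by move=> D /andP[_ zD]; rewrite finset.setD1K.
have fE (D : {set box}) : [seq x <- s | x \in z |: D] = [seq x <- s | x \in D].
  apply: eq_in_filter => x xs; rewrite !inE; case: eqP => // E.
  by rewrite -E xs in zs.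
have z0 : (0 < letter z)%N by apply: letter_gt0.
have cE (D : {set box}) :
  [&& (z |: D \subset z :: s) && (build n r (map letter (if z \in z |: D
      then z :: [seq x <- s | x \in z |: D] else [seq x <- s | x \in z |: D])) == Some a),
      z \in z |: D & (z |: D) :\ z == D] =
  can_unhop (letter z) a && ((D \subset s) &&
      (build n r (map letter [seq x <- s | x \in D]) == Some (swapc (letter z) a))).
  rewrite finset.setU11 fE /= obind_hop_eq_some //.
  move: (can_unhop _ _) => cu; rewrite -!andbA.
  have [zD|zD] := boolP (z \in D).
    have -> : (z |: D) :\ z == D = false.
      by apply/eqP => E; rewrite -E !inE eqxx in zD.
    rewrite !andbF; apply/esym/negbTE/negP => /and3P[_ /fintype.subsetP/(_ z zD)].
    by rewrite (negPf zs).
  rewrite finset.setU1K // eqxx andbT [LHS]andbCA; congr [&& _, _ & _].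
  apply/fintype.subsetP/fintype.subsetP => sub x xD.
    have := sub x; rewrite !inE xD orbT => /(_ isT).
    by case: eqP => // E; rewrite -E xD in zD.
  by move: xD; rewrite !inE => /orP[->//|/sub->]; rewrite orbT.
under eq_bigl => D do rewrite -andbA cE.
case: ifP => cu; last by rewrite big_pred0.
rewrite -IH // mulr_sumr; apply: eq_bigr => D /= /andP[/fintype.subsetP Ds _].
have zD : z \notin D by apply: contra zs; apply: Ds.
rewrite big_setU1 //= eqxx; congr (_ * _); apply: eq_bigr => x xD.
by case: eqP => // E; rewrite -E xD in zD.
Qed.
End Weights.

(** * Hook lengths as weights *)

Lemma conj_partP p i j : is_partition p ->
  (i < conj_part p j)%N = (j < nth 0 p i)%N.
Proof.
move=> /andP[+ _]; rewrite sorted_pairwise; last first.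
  by move=> a b c h1 h2; apply: leq_trans h2 h1.
elim: p i => [|k p IH] i /=; first by rewrite nth_nil.
move=> /andP[/allP kp /IH{}IH]; rewrite /conj_part /= -/(conj_part p j).
have [jk|kj] := ltnP j k; first by case: i.
have -> : conj_part p j = 0%N.
  apply/eqP; rewrite -leqn0 leqNgt -has_count; apply/hasPn => x /kp /=.
  by rewrite -leqNgt => h; apply: leq_trans kj.
case: i => [|i] /=; first by rewrite add0n ltn0 ltnNge kj.
rewrite ltn0; apply/esym/negbTE; rewrite -leqNgt.
have [lt|ge] := ltnP i (size p); last by rewrite nth_default.
by apply: leq_trans kj; apply: kp; apply: mem_nth.
Qed.

Section HookWeights.
Variables (n : nat) (la : seq nat).
Hypotheses (hla : is_partition la) (hn : (size la <= n)%N).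
Notation r := (size la).
Notation d := (head 0%N la).
Notation letter := (@letter n r d).
Notation lam := (diagram la la).
Implicit Types (x y : cell la) (k : 'I_r).

Lemma row_letters k :
  map letter [seq x <- rev [seq (k, j) | j <- enum 'I_d] | x \in lam] =
  rev (iota (n - k) (nth 0%N la k)).
Proof.
rewrite filter_rev map_rev filter_map -map_comp; congr rev.
have le : (nth 0 la k <= d)%N by rewrite -nth0; apply: nth_partition.
have := filter_iota_ltn 0 le; rewrite add0n -val_enum_ord filter_map => E.
rewrite -[(n - k)%N]addn0 iotaDl -E -!map_comp.
rewrite (eq_filter (a2 := fun j : 'I_d => (j < nth 0 la k)%N)); last first.
  by move=> j; rewrite /= inE.
by apply: eq_map => j; rewrite /= /letter /=; have := ltn_ord k; lia.
Qed.

Lemma letter_gt_ground x : (n - r < letter x)%N.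
Proof. by rewrite /letter; have := ltn_ord x.1; lia. Qed.

Lemma swaps_cat u v p : swaps (u ++ v) p = swaps u (swaps v p).
Proof. exact: foldr_cat. Qed.

(** The site left by a cell in column j is pushed back by one in every later row
that meets column j; a site beyond the end of row i is never reached again. *)
Lemma swaps_lower_rows (s : seq 'I_r) i : map val s = iota i (r - i) ->
  let w := map letter [seq x <- rev [seq (k, j) | k <- s, j <- enum 'I_d] | x \in lam] in
  (forall p, (n - i + nth 0 la i <= p)%N -> swaps w p = p) /\
  (forall j, (swaps w (n + j - minn i (conj_part la j)) =
              n + j - minn r (conj_part la j))%N).
Proof.
elim: s i => [|k s IH] i /=.
  case E: (r - i)%N => // _; split=> // j; congr (_ - _)%N.
  have : (conj_part la j <= r)%N by apply: count_size.
  by lia.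
case E: (r - i)%N => [//|m] [Ek Es].
have Es' : map val s = iota i.+1 (r - i.+1) by rewrite Es; congr iota; lia.
have [IH1 IH2] := IH _ Es'.
rewrite rev_cat filter_cat map_cat row_letters Ek.
have nk : (0 < n - i)%N by have := ltn_ord k; lia.
have la1 : (nth 0 la i.+1 <= nth 0 la i)%N by apply: nth_partition.
split=> [p hp|j]; rewrite swaps_cat swaps_rev_iota //.
  case: eqP => [E1|_]; first by lia.
  case: ifP => [h|_]; first by lia.
  by apply: IH1; lia.
have ci := conj_partP i j hla.
have cr : (conj_part la j <= r)%N by apply: count_size.
have ki : (i < r)%N by rewrite -Ek ltn_ord.
rewrite -IH2; congr (swaps _ _); have [lt|ge] := ltnP i (conj_part la j).
  rewrite lt in ci; rewrite (minn_idPl lt).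
  case: eqP => [E1|ne]; first by lia.
  by rewrite (_ : (_ <= _ < _)%N); lia.
rewrite ltnNge ge /= in ci; rewrite (minn_idPr (leqW ge)).
case: eqP => [E1|ne]; first by lia.
by rewrite (_ : (_ <= _ < _)%N = false); lia.
Qed.

(** The two sites exchanged at the cell x end up at the particle of row x.1 of la
and at the hole that belongs to column x.2. *)
Lemma cell_weight_reading (R : comNzRingType) (t : nat -> R) x : x \in lam ->
  cell_weight n t (reading lam) x =
  t (rows n la la x.1) - t (n + x.2 - conj_part la x.2)%N.
Proof.
move=> xl; have xe : x.1 \in enum 'I_r by rewrite mem_enum.
have := pairwise_enum_ord r; have := val_enum_ord r.
rewrite /reading /all_cells.
case/splitPr: xe => p1 p2; rewrite map_cat /= => Ev pw.
have s1 : size p1 = x.1.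
  have := congr1 (fun s => nth 0%N s (size p1)) Ev.
  rewrite nth_cat size_map ltnn subnn /= nth_iota //.
  by have := congr1 size Ev; rewrite size_cat !size_map /= size_iota; lia.
have Ev2 : map val p2 = iota x.1.+1 (r - x.1.+1).
  have := congr1 (drop (size p1).+1) Ev.
  rewrite drop_iota -s1 add0n => <-.
  by rewrite drop_cat size_map ltnNge leqnSn /= subSnn /= drop0.
rewrite allpairs_cat /= !rev_cat !filter_cat -catA.
set A := [seq z <- rev [seq (k, j) | k <- p2, j <- _] | _].
set B := [seq z <- rev (map _ _) | _].
have xA : x \notin A.
  rewrite mem_filter mem_rev; apply/negP => /andP[_ /allpairsP[[k j] [/= kp _ Ex]]].
  move: pw; rewrite pairwise_cat /= => /and4P[_ _ /allP/(_ k kp)].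
  by rewrite Ex /= ltnn.
have xB : x \in B.
  rewrite mem_filter xl mem_rev; apply/mapP; exists x.2; first by rewrite mem_enum.
  by case: (x).
rewrite cell_weight_cat // cell_weight_letter //; last first.
  move=> u v; rewrite !mem_filter !mem_rev.
  move=> /andP[_ /mapP[j _ ->]] /andP[_ /mapP[j' _ ->]].
  exact: letter_inj.
have := swaps_lower_rows Ev2; rewrite -/A => -[A1 A2].
have lt := ltn_ord x.1; have xl2 := xl; rewrite inE /in_diagram in xl2.
rewrite /B row_letters letter_weight_rev_iota; last 2 first.
- by lia.
- by rewrite /letter; lia.
have la1 : (nth 0 la x.1.+1 <= nth 0 la x.1)%N by apply: nth_partition.
rewrite (_ : (letter x).-1 = (n + x.2 - x.1.+1)%N) /=; last by rewrite /letter; lia.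
rewrite A1; last by lia.
have hc : (x.1 < conj_part la x.2)%N by rewrite conj_partP.
have := A2 x.2; rewrite (minn_idPl hc) (minn_idPr (count_size _ _)) => E.
by rewrite E ffunE; congr (t _ - _); lia.
Qed.

(** A hook length is the distance between the particle of its row and the hole of
its column, so for t the identity the weights are the hook lengths. *)
Lemma cell_weight_hook x : x \in lam ->
  cell_weight n (fun p => p%:R : rat) (reading lam) x = (hook x)%:~R.
Proof.
move=> xl; rewrite cell_weight_reading // /hook ffunE.
have lt := ltn_ord x.1; have : (conj_part la x.2 <= r)%N by apply: count_size.
move=> hc; rewrite -[_%:R]/((Posz _)%:~R) -[X in _ - X]/((Posz _)%:~R) -intrB.
by congr (_%:~R); lia.
Qed.

Lemma build_swaps w a : build n r w = Some a ->
  a = [ffun i => swaps w (empty_config n r i)].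
Proof.
elim: w a => [|c w IH] a /=; first by move=> [<-]; apply/ffunP => i; rewrite !ffunE.
case E: (build n r w) => [b|] //=; rewrite /hop; case: ifP => // _ [<-].
by apply/ffunP => i; rewrite (IH b E) !ffunE.
Qed.

(** The generating function of excited diagrams by hooks inside the diagram; it
differs from the sum of inverse hooks over the complements by the factor
equal to the product of all the hooks. *)
Definition excited_sum (a : config r) : rat :=
  \sum_(D : {set cell la} | (D \subset lam) &&
      (build n r (map letter (reading D)) == Some a))
    \prod_(x in D) (hook x)%:~R.

Lemma excited_sum_subwords a :
  excited_sum a =
  subword_sum (empty_config n r) (fun p => p%:R) (map letter (reading lam)) a.
Proof.
rewrite -sum_subwords //; last exact: pairwise_before_uniq (pairwise_reading _).
have E (D : {set cell la}) : (D \subset lam) = (D \subset reading lam).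
  by apply/eq_subset_r => x; rewrite mem_reading.
apply: eq_big => [D|D /andP[/fintype.subsetP sub _]].
  rewrite E; case: (boolP (D \subset _)) => //= /fintype.subsetP sub.
  congr (build _ _ (map _ _) == _); rewrite /reading -filter_predI.
  apply: eq_filter => x /=; case xD: (x \in D) => //=.
  by have := sub x xD; rewrite mem_reading => ->.
by apply: eq_bigr => x /sub xl; rewrite cell_weight_hook.
Qed.

(** The reading word of la takes the empty configuration to rows la la; there the
total of the identity is the number of boxes up to a constant. *)
Lemma excited_sum_chevalley (a : config r) : injective a -> ground n a ->
  cover_sum excited_sum a =
  (\sum_i (rows n la la i)%:R - \sum_i (a i)%:R) * excited_sum a.
Proof.
move=> inja ga; rewrite excited_sum_subwords.
have -> : cover_sum excited_sum a = cover_sum (subword_sum (empty_config n r)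
    (fun p => p%:R) (map letter (reading lam))) a.
  by apply: eq_bigr => i _; rewrite excited_sum_subwords.
rewrite (@subword_sum_chevalley _ _ _ (n - r)) //; last 2 first.
- by apply/allP => _ /mapP[x _ ->]; apply: letter_gt_ground.
- by move=> i; have := ga i; have := ltn_ord i; lia.
- rewrite total_foldl_swap; congr ((_ - _) * _).
  have := build_diagram hla hn hla (fun i j h => h); move/build_swaps => E.
  by apply: eq_bigr => i _; rewrite E [in RHS]ffunE.
move=> i b injb gb ch; apply/eqP => /ffunP E.
have := E i; rewrite !ffunE (swap_bot (b i).+1) => Ei.
have [lt|ge] := ltnP i.+1 r.
  have := E (Ordinal lt); rewrite !ffunE /= => Ek.
  have Eb : b (Ordinal lt) = (b i).+1.
    by apply: (can_inj (swapK (b i).+1)); rewrite swap_top Ek /=; lia.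
  by case/andP: ch => _ /occupiedP[]; exists (Ordinal lt).
by have := gb i; have := ltn_ord i; lia.
Qed.
End HookWeights.

(** * Comparison of the two recursions *)

Section FittingCells.
Local Open Scope nat_scope.
Variables (n r d : nat).
Hypothesis le_rn : r <= n.
Implicit Types (a l : config r).

Definition fit_set a l : {set 'I_r * 'I_d} := [set x | fits n x a l].

Lemma sum_interval p q e : p <= q -> q <= e ->
  \sum_(j < e) (p <= j < q) = q - p.
Proof.
move=> pq qe.
have E : \sum_(j < e) (p <= j < q) = minn q e - minn p e.
  elim: e {qe} => [|e IH]; first by rewrite big_ord0 !minn0.
  by rewrite big_ord_recr /= IH; case: (p <= e) (leqP p e) => -[] // ?; lia.
by rewrite E; lia.
Qed.

Lemma card_fit_set a l : ground n a -> below a l -> in_box n d l ->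
  \sum_i l i = \sum_i a i + #|fit_set a l|.
Proof.
move=> ga ba bl.
have -> : #|fit_set a l| = \sum_(i < r) \sum_(j < d) fits n (i, j) a l.
  rewrite -sum1_card big_mkcond pair_bigA; apply: eq_bigr => -[i j] _ /=.
  by rewrite inE; case: fits.
rewrite -big_split /=; apply: eq_bigr => i _.
have h1 := ga i; have h2 := forallP ba i; have h3 := bl i; have h4 := ltn_ord i.
rewrite (eq_bigr (fun j : 'I_d => (a i - (n - i.+1) <= j < l i - (n - i.+1)) : nat)).
  by rewrite sum_interval; lia.
by move=> j _; rewrite /fits /letter /=; congr nat_of_bool; lia.
Qed.

End FittingCells.

Section Main.
Variables (n m : nat) (la : seq nat).
Hypotheses (hla : is_partition la) (hn : (size la <= n)%N).
Notation r := (size la).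
Notation d := (head 0%N la).
Notation letter := (@letter n r d).
Notation lam := (diagram la la).
Notation l := (rows n la la).
Let K := (n + d).+1.
Implicit Types (a : config r) (x y : cell la).

Definition count_det a : rat := \det (path_mx rat (letters K (m * K)) a l).

Lemma rows_le_K i : (l i <= K)%N.
Proof.
have := in_box_rows n hla (fun _ _ h => h) i; have := ltn_ord i.
by rewrite /K; lia.
Qed.

(** The same recursion as excited_sum_chevalley, with the extra factor m (n + c) for
a box of content c. *)
Lemma count_det_recursion a : strict a -> below a l ->
  (\sum_j (l j)%:R - \sum_i (a i)%:R) * count_det a =
  m%:R * \sum_(i | can_hop (a i).+1 a) (a i).+1%:R * count_det (swapc (a i).+1 a).
Proof.
move=> sa ba; apply: det_path_recursion; first exact: strict_inj.
move=> i j; have [le|lt] := leqP (a i) (l j); last first.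
  by rewrite !paths_lt ?letters_gt0 ?mulr0 //; lia.
rewrite -natrB // -!natrM paths_derivation //; last exact: rows_le_K.
by apply: leq_trans (rows_le_K i); apply: (forallP ba).
Qed.

Lemma paths_refl w p : all (leq 1) w -> paths w p p = 1%N.
Proof.
elim: w => [_|c w IH /= /andP[c0 w0]]; first by rewrite /= eqxx.
rewrite IH //; case: eqP => [E|_]; last by rewrite addn0.
by rewrite paths_lt //; lia.
Qed.

Lemma count_det_top : count_det l = 1.
Proof.
rewrite /count_det det_trig.
  by rewrite big1 // => i _; rewrite mxE paths_refl ?letters_gt0.
apply/is_trig_mxP => i j ij; rewrite mxE paths_lt ?letters_gt0 //.
exact: (strict_rows hn hla) ij.
Qed.

(** Excited diagrams live inside la, so only partitions inside la are built. *)
Lemma excited_sum_nbelow a : ~~ below a l -> excited_sum n a = 0.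
Proof.
move=> nb; rewrite /excited_sum big_pred0 // => D; apply/negP => /andP[Dl /eqP bD].
have [D0 [/fintype.subsetP D0l _ [sa ga ba aE]]] := build_excited hla hn Dl bD.
case/negP: nb; apply/forallP => i; rewrite leqNgt; apply/negP => lt.
have [|x E1 E2] := cell_of_letter hn ba _ (leqnn (a i)).
  by have := ground_rows n la i; lia.
have : x \in lam by apply: D0l; rewrite -mem_reading aE E1 E2.
by rewrite (mem_diagram_rows hn) E1 E2 leqNgt lt.
Qed.

(** The diagram of la admits no excited move. *)
Lemma excited_sum_top : excited_sum n l = \prod_(x in lam) (hook x)%:~R.
Proof.
rewrite /excited_sum (big_pred1 lam) // => D; apply/andP/eqP => [[Dl /eqP bD]|->].
  have [D0 [D0l cn d0]] := build_excited hla hn Dl bD.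
  have E0 : D0 = lam.
    case: d0 => _ _ _ d0; apply/setP => x.
    by rewrite (mem_diagram_rows hn) -d0 mem_reading.
  move: cn; rewrite E0 => /connectP[[|E s] /=]; first by move=> _ ->.
  case/andP => /existsP[x /existsP[y /and5P[_ _ _]]].
  by rewrite finset.setDv inE.
by rewrite fintype.subxx build_diagram.
Qed.

Lemma fit_set_swapc a i : strict a -> ground n a -> can_hop (a i).+1 a ->
  below (swapc (a i).+1 a) l ->
  exists2 x, letter x = (a i).+1 &
    fit_set n d a l = x |: fit_set n d (swapc (a i).+1 a) l /\
    x \notin fit_set n d (swapc (a i).+1 a) l.
Proof.
move=> sa ga ch bs.
have [x hx] := hit_exists hn (in_box_rows n hla (fun _ _ h => h)) (ltn0Sn _) ga ch bs.
exists x; first by case/andP: hx => /eqP.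
split; last by rewrite inE (hitNfits _ _ ch hx).
apply/setP => y; rewrite !inE (fits_swapc hn y _ sa ch bs) // orbC.
congr (_ || _); apply/idP/eqP => [hy|->//].
move: hx hy => /andP[/eqP E1 /eqP E2] /andP[/eqP E3 /eqP E4].
apply: (letter_inj hn); last by rewrite E1.
by apply: (strict_inj sa); rewrite E4.
Qed.

(** Two functions on the partitions inside la with the same recursion, up to the
factor m (n + c) per box, and the same value at la. *)
Lemma count_det_excited a : strict a -> ground n a -> below a l ->
  count_det a * \prod_(x in lam) (hook x)%:~R =
  m%:R ^+ #|fit_set n d a l| * (\prod_(x in fit_set n d a l) (letter x)%:R) *
  excited_sum n a.
Proof.
have [N] := ubnP #|fit_set n d a l|; elim: N a => // N IH a ltN sa ga ba.
have tot := card_fit_set hn ga ba (in_box_rows n hla (fun _ _ h => h)).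
have totR : \sum_j (l j)%:R - \sum_i (a i)%:R = #|fit_set n d a l|%:R :> rat.
  by rewrite -!natr_sum tot natrD addrC addKr.
(* Both sides are 1 times the product of all hooks at a = l; otherwise compare
   the two recursions after multiplication by the number of missing boxes. *)
have [E0|N0] := posnP #|fit_set n d a l|.
  have -> : a = l.
    have /eqP := tot; rewrite E0 addn0 eq_sym => /eqP E.
    apply/ffunP => i; apply/eqP; rewrite eqn_leq (forallP ba) /=.
    rewrite leqNgt; apply/negP => lt.
    suff : (\sum_i a i < \sum_i l i)%N by rewrite E ltnn.
    rewrite (bigD1 i) //= [X in (_ < X)%N](bigD1 i) //= -addSn leq_add //.
    by apply: leq_sum => j _; apply: (forallP ba).
  rewrite count_det_top excited_sum_top mul1r.
  have -> : fit_set n d l l = finset.set0.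
    by apply/setP => x; rewrite !inE /fits; lia.
  by rewrite cards0 big_set0 expr0 !mul1r.
apply: (mulfI (x := #|fit_set n d a l|%:R)); first by rewrite pnatr_eq0 -lt0n.
rewrite mulrA -[in LHS]totR count_det_recursion // [RHS]mulrCA -[in RHS]totR.
rewrite -(excited_sum_chevalley hla hn) //; last exact: strict_inj.
rewrite /cover_sum !mulr_sumr mulr_suml; apply: eq_bigr => i ch.
have sa' := strict_swapc (ltn0Sn _) sa ch; have ga' := ground_swapc (ltn0Sn _) ch ga.
have [bs|nb] := boolP (below (swapc (a i).+1 a) l); last first.
  rewrite excited_sum_nbelow // mulr0 /count_det det_path_nbelow ?mulr0 ?mul0r //.
    exact: letters_gt0.
  exact: strict_rows.
have [x Ex [fE nx]] := fit_set_swapc sa ga ch bs.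
have := IH (swapc (a i).+1 a) _ sa' ga' bs.
move: ltN; rewrite fE cardsU1 nx add1n ltnS => ltN /(_ ltN) IH'.
rewrite big_setU1 //= exprS Ex -!mulrA IH'; ring.
Qed.

End Main.

(** * Lecture hall tableaux *)

Lemma ler_nat_ratio (a b c c' : nat) : (0 < c)%N -> (0 < c')%N ->
  (a%:R / c%:R <= b%:R / c'%:R :> rat) = (a * c' <= b * c)%N.
Proof.
move=> c0 c'0; rewrite ler_pdivrMr ?ltr0n // mulrAC ler_pdivlMr ?ltr0n //.
by rewrite -!natrM ler_nat.
Qed.

Lemma ltr_nat_ratio (a b c c' : nat) : (0 < c)%N -> (0 < c')%N ->
  (a%:R / c%:R < b%:R / c'%:R :> rat) = (a * c' < b * c)%N.
Proof. by move=> c0 c'0; rewrite ltNge ler_nat_ratio // -ltnNge. Qed.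

Section LectureHall.
Variables (n m : nat) (la mu : seq nat).
Hypotheses (hla : is_partition la) (hn : (size la <= n)%N).
Notation r := (size la).
Notation d := (head 0%N la).
Notation letter := (@letter n r d).
Notation K := (n + d).+1.
Notation l := (rows n la la).
Notation b := (rows n la mu).
Implicit Types (L : {ffun cell la -> nat}) (x y : cell la).

Lemma fits_skew x : fits n x b l = (x \in skew_diagram la mu).
Proof. by rewrite finset.in_setD !(mem_diagram_rows hn) /fits ltnNge. Qed.

Definition restrict L : {ffun skew_cell la mu -> nat} := [ffun u => L (val u)].

Lemma lh_ratio_restrict L (u : skew_cell la mu) :
  lh_ratio n (restrict L) u = (L (val u))%:R / (letter (val u))%:R.
Proof. by rewrite /lh_ratio ffunE /content addrA -(letterE hn). Qed.

Lemma letter_bounds x : (0 < letter x < K)%N.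
Proof. by rewrite letter_gt0 //= /letter; have := ltn_ord x.2; lia. Qed.

Lemma letter_right x y : y.1 = x.1 :> nat -> y.2 = x.2.+1 :> nat ->
  letter y = (letter x).+1.
Proof. by rewrite /letter => -> ->; have := ltn_ord x.1; lia. Qed.

Lemma letter_down x y : y.1 = x.1.+1 :> nat -> y.2 = x.2 :> nat ->
  letter x = (letter y).+1.
Proof. by rewrite /letter => E ->; have := ltn_ord y.1; lia. Qed.

(** With K larger than every n + content, the order on keys is the order on ratios
that defines lecture hall tableaux, and the bound on the floors is the bound on
the levels. *)
Lemma tableau_lecture_hall L : (forall x, x \notin skew_diagram la mu -> L x = 0%N) ->
  tableau n l (prec K) (word K (m * K)) b L <-> LHT n m la mu (restrict L).
Proof.
move=> L0.
have inW x : ((L x, letter x) \in word K (m * K)) = (L x < m * letter x)%N.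
  have /andP[x0 xK] := letter_bounds x.
  by rewrite mem_word // level_lt ?x0 // ltnW.
have bound (u : skew_cell la mu) : (Num.floor (lh_ratio n (restrict L) u) < m%:Z) =
    (L (val u) < m * letter (val u))%N.
  rewrite floor_lt_int lh_ratio_restrict.
  have /andP[x0 _] := letter_bounds (val u).
  by rewrite ltr_pdivrMr ?ltr0n // -pmulrn -natrM ltr_nat.
have right (u v : skew_cell la mu) : (val v).1 = (val u).1 :> nat ->
    (val v).2 = (val u).2.+1 :> nat ->
    (lh_ratio n (restrict L) v <= lh_ratio n (restrict L) u) =
    prec K (L (val u), letter (val u)) (L (val v), letter (val v)).
  move=> E1 E2; rewrite !lh_ratio_restrict.
  have := letter_bounds (val u); have := letter_bounds (val v).
  rewrite (letter_right E1 E2) => /andP[_ h1] /andP[h2 h3].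
  by rewrite prec_right // ler_nat_ratio.
have down (u v : skew_cell la mu) : (val v).1 = (val u).1.+1 :> nat ->
    (val v).2 = (val u).2 :> nat ->
    (lh_ratio n (restrict L) v < lh_ratio n (restrict L) u) =
    prec K (L (val u), letter (val u)) (L (val v), letter (val v)).
  move=> E1 E2; rewrite !lh_ratio_restrict.
  have := letter_bounds (val u); have := letter_bounds (val v).
  rewrite (letter_down E1 E2) => /andP[h1 h2] /andP[_ h3].
  by rewrite prec_down // ltr_nat_ratio.
split=> [[_ Lw LR]|[[Lr Ld] Lb]].
  split; [split=> u v E1 E2|move=> u].
  - rewrite right //; apply: LR; rewrite ?fits_skew ?(valP u) ?(valP v) //.
    by rewrite /adjacent E1 E2 !eqxx.
  - rewrite down //; apply: LR; rewrite ?fits_skew ?(valP u) ?(valP v) //.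
    by rewrite /adjacent E1 E2 !eqxx orbT.
  by rewrite bound -inW; apply: Lw; rewrite fits_skew (valP u).
split=> [x|x|x y]; rewrite !fits_skew.
- exact: L0.
- by move=> xs; rewrite inW; have := Lb (exist _ x xs); rewrite bound.
move=> xs ys /orP[] /andP[/eqP E1 /eqP E2].
  by have := Lr (exist _ x xs) (exist _ y ys) E1 E2; rewrite right.
by have := Ld (exist _ x xs) (exist _ y ys) E1 E2; rewrite down.
Qed.

Definition extend (L : {ffun skew_cell la mu -> nat}) : {ffun cell la -> nat} :=
  [ffun x => oapp L 0%N (insub x)].

Lemma extendK : cancel extend restrict.
Proof. by move=> L; apply/ffunP => u; rewrite !ffunE valK. Qed.

Hypotheses (hmu : is_partition mu) (hsub : part_sub mu la).

Lemma below_rows : below b l.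
Proof. by apply/forallP => i; rewrite !ffunE leq_add2l part_sub_nth. Qed.

Let T := tableaux n d l (word K (m * K)) b.

Lemma mem_tableaux L : (L \in T) <->
  tableau n l (prec K) (word K (m * K)) b L.
Proof.
apply: iff_sym; apply: rwP.
apply: (tableauxP hn _ _ (@prec_irr K) (@prec_trans K)).
- exact: strict_rows.
- exact: (in_box_rows n hla (fun _ _ h => h)).
- exact: letters_gt0.
- exact: pairwise_word.
- exact: strict_rows.
- exact: ground_rows.
exact: below_rows.
Qed.

Lemma LHT_tableaux : LHT n m la mu = [set` map restrict T]%classic.
Proof.
apply/seteqP; split=> [L HL|L] /=.
  apply/mapP; exists (extend L); last by rewrite extendK.
  apply/mem_tableaux/tableau_lecture_hall; last by rewrite extendK.
  by move=> x /negPf xs; rewrite ffunE insubF.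
move=> /mapP[L' /mem_tableaux HL' ->]; apply/tableau_lecture_hall => //.
by case: HL' => L0 _ _ x xs; apply: L0; rewrite fits_skew.
Qed.

Lemma card_LHT : #|` fset_set (LHT n m la mu)|%fset = size T.
Proof.
have -> : LHT n m la mu = [set` [fset L in map restrict T]%fset]%classic.
  by rewrite LHT_tableaux; apply/seteqP; split=> L /=; rewrite inE.
rewrite set_fsetK card_fseq undup_id ?size_map // map_inj_in_uniq.
  have bl := in_box_rows n hla (fun _ _ h => h).
  apply: (tableaux_uniq hn _ bl (@prec_irr K) (@prec_trans K)) => //.
  - exact: strict_rows.
  - exact: letters_gt0.
  - exact: pairwise_word.
  - exact: strict_rows.
  - exact: ground_rows.
  exact: below_rows.
move=> L1 L2 /mem_tableaux[Z1 _ _] /mem_tableaux[Z2 _ _] /ffunP E.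
apply/ffunP => x; have [xs|xs] := boolP (x \in skew_diagram la mu).
  by have := E (exist _ x xs); rewrite !ffunE.
by rewrite Z1 ?Z2 ?fits_skew.
Qed.
End LectureHall.

Lemma hook_gt0 la (x : cell la) : is_partition la -> x \in diagram la la ->
  0 < hook x.
Proof.
rewrite inE /in_diagram /hook => hla xl.
by have := conj_partP x.1 x.2 hla; rewrite xl; lia.
Qed.

Unset Implicit Arguments.

Theorem corollary1p4 (n m : nat) (la mu : seq nat)
    (hla : is_partition la) (hmu : is_partition mu)
    (hsub : part_sub mu la) (hn : (size la <= n)%N) :
  finite_set (LHT n m la mu) /\
  (#|` fset_set (LHT n m la mu)|%fset)%:R =
    m%:R ^+ #|skew_diagram la mu| *
    (\prod_(x in skew_diagram la mu) (n%:Z + content x)%:~R) *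
    (\sum_(D : {set cell la} | excited mu D)
       \prod_(x in diagram la la :\: D) ((hook x)%:~R)^-1) :> rat.
Proof.
split; first by rewrite LHT_tableaux //; apply: finite_seq.
rewrite card_LHT // size_tableaux; last first.
- exact: below_rows.
- exact: strict_rows.
- exact: letters_gt0.
- exact: strict_rows.
rewrite -/(letters _ _) -/(count_det n m _).
set H := \prod_(x in diagram la la) (hook x)%:~R : rat.
have H0 : H != 0.
  apply/prodf_neq0 => x xl; rewrite intr_eq0.
  by have := hook_gt0 hla xl; lia.
apply: (mulIf H0); rewrite count_det_excited //; last 3 first.
- exact: strict_rows.
- exact: ground_rows.
- exact: below_rows.
have -> : fit_set n (head 0%N la) (rows n la mu) (rows n la la) = skew_diagram la mu.
  by apply/setP => x; rewrite inE fits_skew.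
rewrite -[RHS]mulrA; congr (_ * _ * _).
  by apply: eq_bigr => x _; rewrite /content addrA -(letterE hn).
rewrite /excited_sum mulr_suml; apply: eq_big => [D|D /andP[Dl _]].
  by rewrite (excitedP hla hn).
rewrite /H [X in _ = _ * X](big_setID D) /= (finset.setIidPr Dl) mulrCA -big_split /=.
rewrite [X in _ * X]big1 ?mulr1 // => x; rewrite finset.in_setD => /andP[_ xl].
by rewrite mulVf // intr_eq0; have := hook_gt0 hla xl; lia.
Qed.
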